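(* For all integers $n\geq 1$, $m\geq 2$ and $1\leq r\leq m$, the maximum forcing number of the quadriculated torus $T(2n+1,2m,2r)$ is $$F(T(2n+1,2m,2r))=\begin{cases} \dfrac{m(2n+1)+(r,m)}{2}, & \text{if } \dfrac{m}{(r,m)} \text{ is odd};\\[2mm] \dfrac{m(2n+1)}{2}, & \text{otherwise},\end{cases}$$ where $(r,m)$ denotes the greatest common divisor of $r$ and $m$.
   Context: Quadriculated torus: for integers $p\ge 2$, $q\ge 3$ and $1\le s\le q$, the quadriculated torus $T(p,q,s)$ is the graph obtained from a $p\times q$ chessboard ($p$ rows, each consisting of $q$ squares) by sticking the left and right sides together and then identifying the top and bottom sides with a torsion of $s$ squares. Explicitly, $T(p,q,s)$ is the simple graph with vertex set $\{v_{i,j} : i\in\{0,\dots,p-1\},\ j\in \mathbb{Z}/q\mathbb{Z}\}$, whose edges are: $v_{i,j}v_{i,j+1}$ for all $i,j$ (second index modulo $q$); $v_{i,j}v_{i+1,j}$ for $0\le i\le p-2$ and all $j$; and $v_{0,j}v_{p-1,j-s}$ for all $j$ (second index modulo $q$). Forcing numbers: let $G$ be a finite graph with a perfect matching $M$. A subset $S\subseteq M$ is a forcing set of $M$ if $S$ is contained in no perfect matching of $G$ other than $M$. The forcing number $f(G,M)$ is the smallest cardinality of a forcing set of $M$. The maximum forcing number $F(G)$ is the maximum of $f(G,M)$ over all perfect matchings $M$ of $G$. *)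

(* Defs.v *)
From mathcomp Require Import all_boot all_order all_algebra.
Set Implicit Arguments.
Unset Strict Implicit.
Unset Printing Implicit Defensive.
Import GRing.Theory.

(* A finite simple graph is a symmetric irreflexive relation e : rel T on a
   finite type T; an edge is the two-element set of its end vertices. *)

Definition edges (T : finType) (e : rel T) : {set {set T}} :=
  [set [set x; y] | x in T, y in T & e x y].

Definition perfect_matching (T : finType) (e : rel T) (M : {set {set T}}) : bool :=
  [&& M \subset edges e, trivIset M & cover M == [set: T]].

Definition forcing_set (T : finType) (e : rel T) (M S : {set {set T}}) : bool :=
  (S \subset M) &&
  [forall M' : {set {set T}}, perfect_matching e M' ==> (S \subset M') ==> (M' == M)].

Definition forcing_number (T : finType) (e : rel T) (M : {set {set T}}) : nat :=
  #|[arg min_(S < M | forcing_set e M S) #|S| ]|.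

Definition max_forcing_number (T : finType) (e : rel T) : nat :=
  \max_(M : {set {set T}} | perfect_matching e M) forcing_number e M.

(* For q >= 2 the ring 'Z_q is the integers modulo q; the torus is only meant
   for p >= 2 and q >= 3. *)
Definition torus_vertex (p q : nat) : finType := ('I_p * 'Z_q)%type.

Definition torus_arc (p q s : nat) : rel (torus_vertex p q) :=
  fun u v =>
    [|| (v.1 == u.1) && (v.2 == u.2 + 1)%R,
        (v.1 == u.1.+1 :> nat) && (v.2 == u.2)
      | [&& u.1 == 0 :> nat, v.1 == p.-1 :> nat & (v.2 == u.2 - s%:R)%R]].

Definition torus (p q s : nat) : rel (torus_vertex p q) :=
  fun u v => torus_arc s u v || torus_arc s v u.

Arguments torus : clear implicits.

Lemma torus_sym (p q s : nat) : symmetric (torus p q s).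
Proof. by move=> u v; rewrite /torus orbC. Qed.

Lemma torus_irr (p q s : nat) : 1 < p -> irreflexive (torus p q s).
Proof.
move=> p1 [i j]; rewrite /torus orbb /torus_arc /=.
rewrite eqxx /= -{1}[j]addr0 (inj_eq (addrI j)) eq_sym oner_eq0 /=.
rewrite -[X in X && _]/(i == i.+1 :> nat) (ltn_eqF (ltnSn i)) /=.
by case: eqP => // -> /=; case: p p1 {i} => [|[]].
Qed.

(* The default M of the arg min in forcing_number is itself a forcing set. *)
Lemma forcing_set_self (T : finType) (e : rel T) (M : {set {set T}}) :
  perfect_matching e M -> forcing_set e M M.
Proof.
case/and3P=> _ _ /eqP cM; rewrite /forcing_set subxx /=.
apply/forallP=> M'; apply/implyP=> /and3P[sM' tM' _]; apply/implyP=> sMM'.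
rewrite eq_sym eqEsubset sMM' /=; apply/subsetP=> A AM'.
have [x xA] : exists x, x \in A.
  by have /imset2P[x y _ _ ->] := subsetP sM' _ AM'; exists x; rewrite !inE eqxx.
have : x \in cover M by rewrite cM inE.
case/bigcupP=> B BM xB; have BM' := subsetP sMM' _ BM.
by rewrite -(def_pblock tM' AM' xA) (def_pblock tM' BM' xB).
Qed.

(* Main.v *)
Require Import Defs.
From mathcomp Require Import all_boot all_order all_algebra.
From mathcomp Require Import zify ring.
Set Implicit Arguments.
Unset Strict Implicit.
Unset Printing Implicit Defensive.
Import Order.TTheory GRing.Theory Num.Theory.

(* Write g for gcd(r, m).  The torus is the quotient of Z^2 by a lattice; it has
   2g closed vertical lines, each of length L = (2n + 1) m / g, and the value to
   be found is g * ceil(L / 2).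

   Lower bound: match the vertical lines in pairs by horizontal rungs.  Two
   consecutive rungs span an alternating square, so a forcing set meets each of
   the g ladders in a vertex cover of a cycle of length L.

   Upper bound: if X is an independent set and no alternating cycle uses only
   the matching edges at X, then the other matching edges form a forcing set.
   Take X of size g * floor(L / 2), locally a translate of the lattice (2Z)^2.
   An alternating cycle along X then moves by v |-> 2 M(v) - v, and this map has
   no periodic point for a perfect matching M of the whole plane.  Non
   contractible cycles are excluded by shifting X by one unit along a
   transversal row: across that row X is out of step, so that cycles lift to
   closed paths in the plane.  The shift leaves one bad vertex z, where the
   shifted row ends; z may be placed anywhere, and choosing it from M keeps it
   off all alternating cycles. *)

(** * Forcing sets and alternating cycles *)

Definition mate (T : finType) (M : {set {set T}}) (x : T) : T :=
  odflt x [pick y | [set x; y] \in M].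

Definition matching_of (T : finType) (mu : T -> T) : {set {set T}} :=
  [set [set x; mu x] | x in T].

Section Matching.
Variables (T : finType) (e : rel T).
Hypotheses (e_sym : symmetric e) (e_irr : irreflexive e).

Let e_neq x y : e x y -> x != y.
Proof. by apply: contraTneq => ->; rewrite e_irr. Qed.

Section Mate.
Variable M : {set {set T}}.
Hypothesis pM : perfect_matching e M.

Lemma mem_matching A : A \in M -> exists x y, e x y /\ A = [set x; y].
Proof.
case/and3P: pM => /subsetP sM _ _ /sM /imset2P[x y _].
by rewrite inE => exy ->; exists x, y.
Qed.

Lemma matching_inj A B x : A \in M -> B \in M -> x \in A -> x \in B -> A = B.
Proof.
case/and3P: pM => _ tM _ AM BM xA xB.
by rewrite -(def_pblock tM AM xA) (def_pblock tM BM xB).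
Qed.

Lemma mate_in x : [set x; mate M x] \in M.
Proof.
rewrite /mate; case: pickP => //= none.
case/and3P: (pM) => _ _ /eqP cM; have : x \in cover M by rewrite cM inE.
case/bigcupP=> A AM; have [y [z [_ eqA]]] := mem_matching AM.
rewrite eqA !inE => /orP[]/eqP eqx.
  by have := none z; rewrite eqx -eqA AM.
by have := none y; rewrite eqx setUC -eqA AM.
Qed.

Lemma mate_adj x : e x (mate M x).
Proof.
have [y [z [eyz eqA]]] := mem_matching (mate_in x).
have : x \in [set y; z] by rewrite -eqA !inE eqxx.
have : mate M x \in [set y; z] by rewrite -eqA !inE eqxx orbT.
have yz := e_neq eyz.
have mx : mate M x != x.
  apply: contra yz => /eqP mx; move/setP: eqA => eqA.
  have := eqA y; have := eqA z; rewrite !inE mx !eqxx orbT !orbb /=.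
  by move=> /eqP-> /eqP->.
rewrite !inE => /orP[]/eqP em /orP[]/eqP ex; move: mx; rewrite em ex ?eqxx //.
by rewrite e_sym.
Qed.

Lemma mateE x y : [set x; y] \in M -> mate M x = y.
Proof.
move=> xyM; have eqA : [set x; y] = [set x; mate M x].
  by apply: (matching_inj (x := x)) => //; rewrite ?mate_in ?inE ?eqxx.
have : mate M x \in [set x; y] by rewrite eqA !inE eqxx orbT.
by rewrite !inE eq_sym (negbTE (e_neq (mate_adj x))) => /eqP.
Qed.

Lemma mateK : involutive (mate M).
Proof. by move=> x; apply: mateE; rewrite setUC mate_in. Qed.

Lemma matchingE A x : A \in M -> x \in A -> A = [set x; mate M x].
Proof. by move=> AM xA; apply: (matching_inj (x := x)) => //; rewrite ?mate_in ?inE ?eqxx. Qed.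

End Mate.

Lemma mate_eq M M' : perfect_matching e M -> perfect_matching e M' ->
  mate M =1 mate M' -> M = M'.
Proof.
move=> pM pM' eqm; apply/setP => A; apply/idP/idP => [AM|AM].
  have [x [y [_ eqA]]] := mem_matching pM AM.
  by rewrite (matchingE pM AM (x := x)) ?eqA ?inE ?eqxx // eqm mate_in.
have [x [y [_ eqA]]] := mem_matching pM' AM.
by rewrite (matchingE pM' AM (x := x)) ?eqA ?inE ?eqxx // -eqm mate_in.
Qed.

Lemma matching_ofP mu : involutive mu -> (forall x, e x (mu x)) ->
  perfect_matching e (matching_of mu).
Proof.
move=> muK emu; apply/and3P; split.
- apply/subsetP => _ /imsetP[x _ ->]; apply/imset2P.
  by exists x (mu x); rewrite ?inE ?emu.
- apply/trivIsetP => _ _ /imsetP[x _ ->] /imsetP[y _ ->].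
  apply: contraR => /pred0Pn[z /=]; rewrite !inE.
  case/andP=> /orP[]/eqP-> /orP[]/eqP.
  + by move=> ->.
  + by move=> ->; rewrite muK setUC.
  + by move=> <-; rewrite muK setUC.
  + by move=> /(can_inj muK)->.
- apply/eqP/setP => x; rewrite inE; apply/bigcupP.
  by exists [set x; mu x]; [exact: imset_f | rewrite !inE eqxx].
Qed.

Lemma mate_matching_of mu : involutive mu -> (forall x, e x (mu x)) ->
  mate (matching_of mu) =1 mu.
Proof. by move=> muK emu x; apply: mateE (matching_ofP muK emu) _ _ _; apply: imset_f. Qed.

Lemma card_matching M : perfect_matching e M -> (#|M| * 2)%N = #|T|.
Proof.
move=> pM; case/and3P: (pM) => _ tM /eqP cM.
rewrite -cardsT -cM -(eqP tM) (eq_bigr (fun=> 2)) ?sum_nat_const // => A AM.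
by have [x [y [exy ->]]] := mem_matching pM AM; rewrite cards2 e_neq.
Qed.

Section Upper.
Variables (M : {set {set T}}) (X : {set T}).
Hypotheses (pM : perfect_matching e M)
  (indep : forall x y, x \in X -> y \in X -> ~~ e x y)
  (acyclic : forall (c : nat -> T) n, (0 < n)%N -> (forall k, c (k + n)%N = c k) ->
    (forall k, c k \in X) -> (forall k, e (c k) (mate M (c k.+1))) ->
    (forall k, c k != c k.+1) -> False).

Lemma forcing_number_upper : (forcing_number e M + #|X| <= #|M|)%N.
Proof.
pose E := [set [set x; mate M x] | x in X].
have cardE : #|E| = #|X|.
  apply: card_in_imset => x y xX yX eqxy.
  have : y \in [set x; mate M x] by rewrite eqxy !inE eqxx.
  rewrite !inE => /orP[]/eqP // eqy.
  by have := indep xX yX; rewrite eqy mate_adj.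
have sEM : E \subset M by apply/subsetP => _ /imsetP[x _ ->]; apply: mate_in.
have fS : forcing_set e M (M :\: E).
  rewrite /forcing_set subsetDl /=; apply/forallP => M'; apply/implyP => pM'.
  apply/implyP => /subsetP sS; apply/eqP; apply: mate_eq => // x0.
  apply/eqP; apply: contraT => ne0.
  have keep v : v \notin X -> mate M v \notin X -> mate M' v = mate M v.
    move=> vX mX; apply: mateE => //; apply: sS; rewrite inE mate_in // andbT.
    apply/imsetP => -[x xX eqA].
    have : x \in [set v; mate M v] by rewrite eqA !inE eqxx.
    by rewrite !inE => /orP[]/eqP eqx; move: xX; rewrite eqx ?(negbTE vX) ?(negbTE mX).
  have [x xX nex] : exists2 x, x \in X & mate M' x != mate M x.
    have [?|x0X] := boolP (x0 \in X); first by exists x0.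
    have [mX|mX] := boolP (mate M x0 \in X); last by rewrite keep ?eqxx in ne0.
    exists (mate M x0) => //; rewrite mateK //; apply: contra ne0 => /eqP {1}<-.
    by rewrite mateK.
  pose psi y := mate M (mate M' y).
  have psi_inj : injective psi by apply: inj_comp; apply: can_inj (mateK _).
  have psiX y : y \in X -> psi y \in X.
    move=> yX; have eym := mate_adj pM' y.
    have mX : mate M' y \notin X by apply: contraL eym => /(indep yX).
    apply: contraLR yX => pX; rewrite -(mateK pM' y) keep //.
  exfalso; apply: (acyclic (c := fun k => iter k psi x) (n := order psi x)).
  - exact: order_gt0.
  - by move=> k; rewrite iterD iter_order.
  - by elim=> //= k; apply: psiX.
  - by move=> k; rewrite iterS /psi mateK //; apply: mate_adj.
  - elim=> [|k]; last by rewrite !iterS (inj_eq psi_inj).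
    by apply: contra nex => /= /eqP {2}->; rewrite /psi mateK.
have : (forcing_number e M <= #|M :\: E|)%N.
  by rewrite /forcing_number; case: arg_minnP => [|S _]; [exact: forcing_set_self | apply].
rewrite cardsD (setIidPr sEM) cardE => le.
by rewrite addnC -leq_subRL // -cardE subset_leq_card.
Qed.

End Upper.

Lemma forcing_square M S x y : perfect_matching e M -> forcing_set e M S ->
  e x y -> e (mate M x) (mate M y) -> y != mate M x ->
  ([set x; mate M x] \in S) || ([set y; mate M y] \in S).
Proof.
move=> pM /andP[/subsetP sSM /forallP fS] exy emxy ne.
rewrite -implyNb; apply/implyP => xS; apply: contraT => yS.
have mx := e_neq (mate_adj pM x); have my := e_neq (mate_adj pM y).
have mK := mateK pM; have xy := e_neq exy.
have ne' : x != mate M y by apply: contra ne => /eqP->; rewrite mK.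
have mxy : mate M x != mate M y by rewrite (inj_eq (can_inj mK)).
pose mu v := if v == x then y else if v == y then x else
  if v == mate M x then mate M y else if v == mate M y then mate M x else mate M v.
have muK : involutive mu.
  move=> v; rewrite /mu.
  case: (eqVneq v x) => [->|vx]; first by rewrite eq_sym (negbTE xy) eqxx.
  case: (eqVneq v y) => [->|vy]; first by rewrite eqxx.
  case: (eqVneq v (mate M x)) => [->|vmx].
    by rewrite eq_sym (negbTE ne') eq_sym (negbTE my) eq_sym (negbTE mxy) eqxx.
  case: (eqVneq v (mate M y)) => [->|vmy].
    by rewrite eq_sym (negbTE mx) eq_sym (negbTE ne) eqxx.
  by rewrite !(can2_eq mK mK) !mK (negbTE vx) (negbTE vy) (negbTE vmx) (negbTE vmy).
have emu v : e v (mu v).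
  rewrite /mu; case: eqP => [->//|_]; case: eqP => [->|_]; first by rewrite e_sym.
  case: eqP => [->//|_]; case: eqP => [->|_]; first by rewrite e_sym.
  exact: mate_adj.
have sS : S \subset matching_of mu.
  apply/subsetP => A AS; have AM := sSM _ AS.
  have [v [w [_ eqA]]] := mem_matching pM AM.
  have eA : A = [set v; mate M v] by apply: matchingE => //; rewrite eqA !inE eqxx.
  have nA z : [set z; mate M z] \notin S -> v != z.
    by apply: contraNneq => <-; rewrite -eA.
  have nA' z : [set z; mate M z] \notin S -> v != mate M z.
    by apply: contraNneq => ev; rewrite setUC -ev -(mK z) -ev -eA.
  apply/imsetP; exists v => //; rewrite /mu eA.
  by rewrite (negbTE (nA _ xS)) (negbTE (nA _ yS)) (negbTE (nA' _ xS)) (negbTE (nA' _ yS)).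
have /implyP/(_ (matching_ofP muK emu))/implyP/(_ sS)/eqP eM := fS (matching_of mu).
by have := mate_matching_of muK emu x; rewrite eM /mu eqxx => eqy; rewrite -eqy eqxx in ne.
Qed.

End Matching.

Local Open Scope ring_scope.

(** * Perfect matchings of the plane *)

Lemma iter_periodic (T : eqType) (f : T -> T) (x : T) (s : seq T) :
  (forall k, iter k f x \in s) ->
  exists i n : nat, (0 < n)%N /\ iter n f (iter i f x) = iter i f x.
Proof.
move=> xs.
have : ~~ uniq (traject f x (size s).+1).
  have sub : {subset traject f x (size s).+1 <= s} by move=> _ /trajectP[k _ ->].
  by apply/negP => /uniq_leq_size/(_ sub); rewrite size_traject ltnn.
rewrite looping_uniq negbK => /trajectP[i ltin eqi].
by exists i, (size s - i)%N; rewrite -iterD subnK ?subn_gt0 // ltnW.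
Qed.

Definition nbr (v w : int * int) : bool :=
  (`|w.1 - v.1| + `|w.2 - v.2| == 1)%N.

Definition leap (m : int * int -> int * int) (v : int * int) : int * int :=
  ((m v).1 * 2 - v.1, (m v).2 * 2 - v.2).

Lemma crossing_cut (cx cy mx my fx fy px : int) :
  mx - cx = 0 /\ (my - cy = 1 \/ my - cy = -1) \/ my - cy = 0 /\ (mx - cx = 1 \/ mx - cx = -1) ->
  fx = px - 1 \/ fx = px + 1 -> ((cx - px) %% 2 = 0)%Z -> ((cy - fy) %% 2 = 1)%Z ->
  (mx <> px \/ my <> fy) ->
  ((mx == px * 2 - fx) && (fy < my)) (+) ((mx == fx) && (fy < my)) =
  ((cx == px) && (fy < cy)) (+) ((mx * 2 - cx == px) && (fy < my * 2 - cy)).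
Proof.
move=> step face parx pary ne; case: step => [[e1 e2]|[e1 e2]].
  have -> : (mx == px * 2 - fx) = false by clear -e1 face parx; lia.
  have -> : (mx == fx) = false by clear -e1 face parx; lia.
  have -> : (mx * 2 - cx == px) = (cx == px) by clear -e1; lia.
  case: (cx =P px) => //= ecx.
  have -> : (fy < my * 2 - cy) = (fy < cy) by clear -ecx e1 e2 pary ne; lia.
  by rewrite addbb.
have -> : my * 2 - cy = cy by clear -e1; lia.
have -> : my = cy by clear -e1; lia.
case: (fy < cy); rewrite ?andbF // !andbT; clear - face e2.
case: face => ->; case: e2 => e2.
- have -> : (mx == px * 2 - (px - 1)) = (cx == px) by clear -e2; lia.
  by have -> : (mx == px - 1) = (mx * 2 - cx == px) by clear -e2; lia.
- have -> : (mx == px * 2 - (px - 1)) = (mx * 2 - cx == px) by clear -e2; lia.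
  have -> : (mx == px - 1) = (cx == px) by clear -e2; lia.
  by rewrite addbC.
- have -> : (mx == px * 2 - (px + 1)) = (mx * 2 - cx == px) by clear -e2; lia.
  have -> : (mx == px + 1) = (cx == px) by clear -e2; lia.
  by rewrite addbC.
- have -> : (mx == px * 2 - (px + 1)) = (cx == px) by clear -e2; lia.
  by have -> : (mx == px + 1) = (mx * 2 - cx == px) by clear -e2; lia.
Qed.

Lemma nbr_step v w : nbr v w ->
  w.1 - v.1 = 0 /\ (w.2 - v.2 = 1 \/ w.2 - v.2 = -1) \/
  w.2 - v.2 = 0 /\ (w.1 - v.1 = 1 \/ w.1 - v.1 = -1).
Proof. by rewrite /nbr; lia. Qed.

Section Planar.
Variable m : int * int -> int * int.
Hypothesis mK : involutive m.
Hypothesis m_nbr : forall v, nbr v (m v).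

Section Orbit.
Variables (v : int * int) (n : nat).
Hypothesis per : iter n (leap m) v = v.

Let c k := iter k (leap m) v.

Let cSn i : c i.+1 = leap m (c i). Proof. by []. Qed.

Let cut (A : pred (int * int)) :
  \big[addb/false]_(i < n) (A (c i) (+) A (c i.+1)) = false.
Proof.
have -> : forall k, \big[addb/false]_(i < k) (A (c i) (+) A (c i.+1)) = A (c 0) (+) A (c k).
  elim=> [|k IH]; first by rewrite big_ord0 addbb.
  by rewrite big_ord_recr /= IH -addbA [A (c k) (+) _]addbA addbb addFb.
by rewrite /c per addbb.
Qed.

(* For a vertex f of the opposite parity class (a "dual" vertex), the parity of
   the number of crossings of the closed orbit with the upward ray from f. *)
Definition wind (f : int * int) : bool :=
  \big[addb/false]_(i < n) (((m (c i)).1 == f.1) && (f.2 < (m (c i)).2)).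

Definition offclass (f : int * int) : bool :=
  ((f.1 - v.1 - 1) %% 2 == 0)%Z && ((f.2 - v.2 - 1) %% 2 == 0)%Z.

Lemma c_class i : (((c i).1 - v.1) %% 2 = 0)%Z /\ (((c i).2 - v.2) %% 2 = 0)%Z.
Proof. by elim: i => [|i [IH1 IH2]]; rewrite ?cSn /leap /=; lia. Qed.

Lemma off_neq f i : offclass f -> ((m (c i)).1 == (m f).1) && ((m (c i)).2 == (m f).2) = false.
Proof.
move=> off; apply/negP => /andP[/eqP e1 /eqP e2].
have /(can_inj mK) cf : m (c i) = m f by rewrite [LHS]surjective_pairing e1 e2 -surjective_pairing.
by have [? ?] := c_class i; move: off; rewrite -cf /offclass; lia.
Qed.

Lemma offclass_leap f : offclass f -> offclass (leap m f).
Proof. by rewrite /offclass /leap /=; lia. Qed.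

(* A dual step never crosses the orbit: a common midpoint would be the partner
   of two vertices. *)
Lemma wind_leap f : offclass f -> wind (leap m f) = wind f.
Proof.
move=> off; have := m_nbr f; rewrite /nbr => nf.
case: (eqVneq (m f).2 f.2) => [hor|ver].
  suff: wind (leap m f) (+) wind f = false by do 2!case: (wind _).
  rewrite /wind -big_split /=.
  rewrite -[RHS](cut (fun u => (u.1 == (m f).1) && (f.2 < u.2))).
  apply: eq_bigr => i _; rewrite cSn /leap /= hor.
  have -> : f.2 * 2 - f.2 = f.2 by clear; lia.
  have [h1 h2] := c_class i; have /andP[/eqP o1 /eqP o2] := off; have ne := off_neq i off.
  apply: crossing_cut; first exact: nbr_step.
  - by clear -nf hor; lia.
  - by clear -nf hor h1 o1; lia.
  - by clear -h2 o2; lia.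
  - by clear -ne hor; lia.
apply: eq_bigr => i _.
have := off_neq i off; have := m_nbr (c i); have [] := c_class i; move: off.
rewrite /offclass /nbr /leap /=; lia.
Qed.

Lemma wind_witness f : wind f ->
  exists2 i, (i < n)%N & (m (c i)).1 = f.1 /\ f.2 < (m (c i)).2.
Proof.
move=> wf; have [/existsP[i /andP[/eqP ? ?]]|none] :=
  boolP [exists i : 'I_n, ((m (c i)).1 == f.1) && (f.2 < (m (c i)).2)].
  by exists i.
move: wf; rewrite /wind big1 // => i _; apply/negbTE; apply: contra none => Pi.
by apply/existsP; exists i.
Qed.

Lemma wind_low f : (forall i, f.2 < (m (c i)).2) -> offclass f -> wind f = false.
Proof.
move=> low off; rewrite -[RHS](cut (fun u => f.1 < u.1)).
apply: eq_bigr => i _; rewrite cSn.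
have := low i; have := m_nbr (c i); have [] := c_class i; move: off.
rewrite /offclass /nbr /leap /=; lia.
Qed.

Hypothesis n_gt0 : (0 < n)%N.
Hypothesis n_min : forall k, (0 < k < n)%N -> iter k (leap m) v <> v.

Let c_inj i j : (i < n)%N -> (j < n)%N -> c i = c j -> i = j.
Proof.
wlog: i j / (i <= j)%N.
  by move=> W ? ? ?; case: (leqP i j) => [|/ltnW] ?; [|symmetry]; apply: W.
rewrite leq_eqVlt => /predU1P[//|ltij] _ ltjn eqc.
have : c (n - j + i)%N = v by rewrite /c iterD -/(c i) eqc /c -iterD subnK ?per // ltnW.
by move/n_min => []; lia.
Qed.

Lemma wind_exists : exists f, offclass f && wind f.
Proof.
have i0 : 'I_n by exists 0.
pose i := [arg max_(i > i0) (c i).2]%O.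
have top k : (c k).2 <= (c i).2.
  have -> : c k = c (k %% n)%N.
    rewrite {1}(divn_eq k n) /c addnC iterD; congr iter.
    by elim: (k %/ n)%N => // q IH; rewrite mulSn iterD IH per.
  by rewrite /i; case: arg_maxP => // j _ /(_ (Ordinal (ltn_pmod k n_gt0)) isT).
have [k ltkn [kh kt]] : exists2 k, (k < n)%N & (m (c k)).2 = (c k).2 /\ (c k).2 = (c i).2.
  case: (eqVneq (m (c i)).2 (c i).2) => [?|down]; first by exists i.
  pose k := if i == 0%N :> nat then n.-1 else i.-1.
  have ck : leap m (c k) = c i.
    rewrite -cSn /k; case: eqP => [->|]; first by rewrite prednK // /c per.
    by case: (nat_of_ord i).
  have ltkn : (k < n)%N by have := ltn_ord i; rewrite /k; case: eqP; lia.
  have nek : (m (c k)).1 = (m (c i)).1 -> (m (c k)).2 <> (m (c i)).2.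
    move=> e1 e2; have /(can_inj mK)/c_inj : m (c k) = m (c i).
      by rewrite [LHS]surjective_pairing e1 e2 -surjective_pairing.
    move=> /(_ ltkn (ltn_ord i)) eqk; have := congr1 snd ck; rewrite eqk /leap /=; lia.
  have := top i.+1; have := top k; rewrite cSn /=.
  have := congr1 fst ck; have := congr1 snd ck; rewrite /leap /=.
  have := m_nbr (c k); have := m_nbr (c i); rewrite /nbr => ni nk e2 e1 topk topi.
  have hor : (m (c k)).2 = (c k).2 by case: (eqVneq (m (c k)).2 (c k).2) => // ?; case: nek; lia.
  by exists k => //; split=> //; lia.
exists ((m (c k)).1, (c k).2 - 1); apply/andP; split.
  have := m_nbr (c k); have [] := c_class k; rewrite /offclass /nbr /=; lia.
rewrite /wind (bigD1 (Ordinal ltkn)) //= eqxx kh big1 ?addbF; first by lia.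
move=> j /eqP nej; apply/negP => /andP[/eqP e1 lt2]; apply: nej; apply: val_inj => /=.
apply: c_inj => //; apply: (can_inj mK).
rewrite [LHS]surjective_pairing [RHS]surjective_pairing e1; congr (_, _).
have := top j; have := top j.+1; rewrite cSn; have := m_nbr (c j).
move: lt2; rewrite /nbr /leap /=; lia.
Qed.

End Orbit.

Lemma wind_inside (lo hi : int) (v : int * int) (n : nat) (f : int * int) :
  iter n (leap m) v = v -> (forall k, lo <= (iter k (leap m) v).2 <= hi) ->
  offclass v f -> wind v n f ->
  exists2 i, (i < n)%N & (m (iter i (leap m) v)).1 = f.1 /\ lo < f.2 < hi.
Proof.
move=> per strip off wf.
have strip' i : lo <= (m (iter i (leap m) v)).2 * 2 - (iter i (leap m) v).2 <= hi.
  exact: strip i.+1.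
have mid i : lo <= (m (iter i (leap m) v)).2 <= hi.
  have := strip i; have := strip' i; lia.
have [i ltin [e1 lt2]] := wind_witness wf; exists i => //; split=> //.
apply/andP; split; last by apply: lt_le_trans lt2 _; case/andP: (mid i).
rewrite ltNge; apply/negP => le2; suff: wind v n f = false by rewrite wf.
apply: wind_low => // k /=; have ne : (iter k (leap m) v).2 <> f.2.
  by have [_] := c_class v k; case/andP: off => _; lia.
by have := strip k; have := strip' k; have := mid k; lia.
Qed.

(* A periodic orbit encloses a dual vertex, whose forward orbit stays enclosed
   and is thus eventually periodic, in a lower strip. *)
Lemma leap_strip (h : nat) (lo : int) (v : int * int) (n : nat) :
  (0 < n)%N -> iter n (leap m) v = v ->
  (forall k, lo <= (iter k (leap m) v).2 <= lo + h%:Z) -> False.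
Proof.
elim: h lo v n => [|h IH] lo v N N_gt0 perN strip;
  have exn : exists n, (0 < n)%N && (iter n (leap m) v == v)
    by exists N; rewrite N_gt0 perN eqxx.
all: case: (ex_minnP exn) => n /andP[n_gt0 /eqP per] min.
all: have n_min k : (0 < k < n)%N -> iter k (leap m) v <> v
  by case/andP=> k0 ltkn e; have := min k; rewrite k0 e eqxx leqNgt ltkn => /(_ isT).
all: have [f /andP[off wf]] := wind_exists per n_gt0 n_min.
  by have [_ _ [_]] := wind_inside per strip off wf; lia.
have inv k : offclass v (iter k (leap m) f) && wind v n (iter k (leap m) f).
  elim: k => [|k /andP[offk wk]]; first by rewrite off.
  by rewrite iterS wind_leap // offclass_leap.
have inside k : exists2 i, (i < n)%N & (m (iter i (leap m) v)).1 = (iter k (leap m) f).1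
    /\ lo < (iter k (leap m) f).2 < lo + h.+1%:Z.
  by case/andP: (inv k); apply: wind_inside.
pose s := [seq ((m (iter i (leap m) v)).1, lo + j%:Z) | i <- iota 0 n, j <- iota 0 h.+1].
have [|i [k [k_gt0 perk]]] := @iter_periodic _ (leap m) f s.
  move=> k; have [i ltin [e1 e2]] := inside k.
  apply/allpairsP; exists (i, `|(iter k (leap m) f).2 - lo|%N); rewrite !mem_iota /=; split=> //.
    by lia.
  by rewrite [LHS]surjective_pairing -e1; congr (_, _); lia.
apply: (IH (lo + 1) (iter i (leap m) f) k k_gt0 perk) => j.
by rewrite -iterD; have [_ _ [_]] := inside (j + i)%N; lia.
Qed.

Theorem leap_aperiodic (v : int * int) (n : nat) : (0 < n)%N -> iter n (leap m) v <> v.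
Proof.
move=> n_gt0 per; pose B := \max_(i < n) `|(iter i (leap m) v).2|%N.
apply: (@leap_strip (B + B)%N (- B%:Z) v n n_gt0 per) => k.
suff : (`|(iter k (leap m) v).2| <= B)%N by lia.
have -> : iter k (leap m) v = iter (k %% n)%N (leap m) v.
  rewrite {1}(divn_eq k n) addnC iterD; congr iter.
  by elim: (k %/ n)%N => // q IH; rewrite mulSn iterD IH per.
exact: (leq_bigmax (Ordinal (ltn_pmod k n_gt0))).
Qed.

End Planar.

(** * Quotients of the plane grid *)

(* T is the quotient of the grid Z^2 by the lattice spanned by (2g, -s) and (0, L). *)
Definition covers (T : finType) (e : rel T) (pr : int * int -> T) (g L : nat) (s : int) : Prop :=
  [/\ forall t, exists v, pr v = t,
      forall v w, pr v = pr w <->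
        exists u k : int, v.1 - w.1 = 2 * g%:Z * u /\ v.2 - w.2 = k * L%:Z - u * s
    & forall v t, e (pr v) t <-> exists2 w, nbr v w & t = pr w].

Section Covers.
Variables (T : finType) (e : rel T) (g L : nat) (s : int).

Lemma covers_shift pr (a b : int) : covers e pr g L s ->
  covers e (fun v => pr (v.1 + a, v.2 + b)) g L s.
Proof.
case=> sur ker adj; split=> [t|v w|v t].
- by have [v <-] := sur t; exists (v.1 - a, v.2 - b); rewrite /= !subrK -surjective_pairing.
- rewrite ker /=; split=> -[u [k [h1 h2]]]; exists u, k; lia.
- rewrite adj /nbr /=; split=> -[w nw ->].
    by exists (w.1 - a, w.2 - b); rewrite /= ?subrK -?surjective_pairing //; lia.
  by exists (w.1 + a, w.2 + b) => //=; lia.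
Qed.

Lemma covers_flip pr : covers e pr g L s -> covers e (fun v => pr (v.1, - v.2)) g L (- s).
Proof.
case=> sur ker adj; split=> [t|v w|v t].
- by have [v <-] := sur t; exists (v.1, - v.2); rewrite /= opprK -surjective_pairing.
- by rewrite ker /=; split=> -[u [k [h1 h2]]]; exists u, (- k); lia.
- rewrite adj /nbr /=; split=> -[w nw ->].
    by exists (w.1, - w.2); rewrite /= ?opprK -?surjective_pairing //; lia.
  by exists (w.1, - w.2) => //=; lia.
Qed.

Lemma covers_mod pr (k : int) : covers e pr g L s -> covers e pr g L (s + k * L%:Z).
Proof.
case=> sur ker adj; split=> // v w; rewrite ker; split=> -[u [t [h1 h2]]].
  by exists u, (t + u * k); split; [|rewrite h2; lia].
by exists u, (t - u * k); split; [|rewrite h2; lia].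
Qed.

End Covers.

Section Lift.
Variables (T : finType) (e : rel T) (pr : int * int -> T) (g L : nat) (s : int).
Hypothesis cov : covers e pr g L s.
Variable mu : T -> T.
Hypothesis mu_adj : forall x, e x (mu x).

(* The lift to Z^2 of a perfect matching with partner function mu. *)
Definition plane_mate (v : int * int) : int * int :=
  if pr (v.1 + 1, v.2) == mu (pr v) then (v.1 + 1, v.2) else
  if pr (v.1 - 1, v.2) == mu (pr v) then (v.1 - 1, v.2) else
  if pr (v.1, v.2 + 1) == mu (pr v) then (v.1, v.2 + 1) else (v.1, v.2 - 1).

Lemma plane_mate_nbr v : nbr v (plane_mate v).
Proof. by rewrite /plane_mate /nbr; do 3![case: ifP => _ /=; first by lia]; rewrite /=; lia. Qed.

Lemma pr_plane_mate v : pr (plane_mate v) = mu (pr v).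
Proof.
rewrite /plane_mate; case: eqP => // n1; case: eqP => // n2; case: eqP => // n3.
case: cov => _ _ adj; have /adj[w nw eqw] := mu_adj (pr v).
rewrite eqw; congr pr; rewrite [w]surjective_pairing.
case: w nw eqw => x y /= nw eqw.
have h1 : (x, y) <> (v.1 + 1, v.2) by move=> E; rewrite -E -eqw in n1.
have h2 : (x, y) <> (v.1 - 1, v.2) by move=> E; rewrite -E -eqw in n2.
have h3 : (x, y) <> (v.1, v.2 + 1) by move=> E; rewrite -E -eqw in n3.
have d1 : x = v.1 + 1 -> y <> v.2 by move=> E1 E2; apply: h1; rewrite E1 E2.
have d2 : x = v.1 - 1 -> y <> v.2 by move=> E1 E2; apply: h2; rewrite E1 E2.
have d3 : x = v.1 -> y <> v.2 + 1 by move=> E1 E2; apply: h3; rewrite E1 E2.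
by move: nw; rewrite /nbr /= => nw; congr (_, _); lia.
Qed.

Hypotheses (g_gt0 : (0 < g)%N) (L_gt2 : (2 < L)%N).
Hypothesis thick : (1 < g)%N \/ ~~ (L%:Z %| s)%Z.

Lemma covers_locinj v w w' : nbr v w -> nbr v w' -> pr w = pr w' -> w = w'.
Proof.
case: cov => _ ker _; rewrite ker => nw nw' [u [k [h1 h2]]].
have u1 : `|u| <= 1 by move: nw nw'; rewrite /nbr; nia.
have k1 : u = 0 -> `|k| <= 0 by move=> u0; move: h2 nw nw'; rewrite u0 /nbr; nia.
have [u0|u0] := eqVneq u 0.
  move: h1 h2; rewrite u0; have -> : k = 0 by have := k1 u0; lia.
  by move=> h1 h2; rewrite [w]surjective_pairing [w']surjective_pairing; congr (_, _); lia.
case: thick => [g1|/negP[]]; first by move: nw nw'; rewrite /nbr; nia.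
apply/dvdzP; exists (u * k).
have e2 : w.2 - w'.2 = 0 by move: nw nw'; rewrite /nbr; nia.
have uu : u * u = 1 by nia.
by rewrite -mulrA; move: h2; rewrite e2; nia.
Qed.

Hypothesis muK : involutive mu.

Lemma plane_mateK : involutive plane_mate.
Proof.
move=> v; apply: (@covers_locinj (plane_mate v)); first exact: plane_mate_nbr.
  by have := plane_mate_nbr v; rewrite /nbr; lia.
by rewrite !pr_plane_mate muK.
Qed.

Lemma plane_mate_pr v w : pr v = pr w ->
  (plane_mate v).1 - v.1 = (plane_mate w).1 - w.1 /\ (plane_mate v).2 - v.2 = (plane_mate w).2 - w.2.
Proof.
move=> eqp.
suff E : plane_mate w = (w.1 + ((plane_mate v).1 - v.1), w.2 + ((plane_mate v).2 - v.2)) by rewrite E /=; lia.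
apply: (@covers_locinj w); first exact: plane_mate_nbr.
  by have := plane_mate_nbr v; rewrite /nbr /=; lia.
rewrite pr_plane_mate -eqp -pr_plane_mate; case: cov => _ ker _.
have /ker[u [k [h1 h2]]] := eqp; apply/ker; exists u, k => /=; lia.
Qed.

End Lift.

Section CoverUpper.
Variables (T : finType) (e : rel T) (pr : int * int -> T) (g L : nat) (s : int).
Hypotheses (e_sym : symmetric e) (e_irr : irreflexive e) (cov : covers e pr g L s).
Hypotheses (g_gt0 : (0 < g)%N) (L_gt2 : (2 < L)%N).
Hypothesis thick : (1 < g)%N \/ ~~ (L%:Z %| s)%Z.
Variable M : {set {set T}}.
Hypothesis pM : perfect_matching e M.
Let m := plane_mate pr (mate M).

Variables (K : finType) (d : K -> int * int) (Z : pred K).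
Hypothesis inj : injective (fun k => pr (d k)).
Hypothesis indep : forall k k' w, nbr (d k) w -> pr w <> pr (d k').

Definition arrow (k' k : K) : Prop := exists2 w, nbr (d k) w & pr w = pr (m (d k')).

Hypothesis straight : forall k k', k != k' -> ~~ Z k -> ~~ Z k' -> arrow k' k ->
  d k = leap m (d k').
Hypothesis no_return : forall (c : nat -> K) n, (0 < n)%N -> Z (c 0%N) -> Z (c n) ->
  (forall i, (0 < i < n)%N -> ~~ Z (c i)) -> (forall i, arrow (c i.+1) (c i)) ->
  (forall i, c i != c i.+1) -> False.

Lemma forcing_cover : (forcing_number e M + #|K| <= #|M|)%N.
Proof.
pose X := [set pr (d k) | k in K].
have -> : #|K| = #|X| by rewrite card_imset.
have [_ _ adj] := cov.
apply: (forcing_number_upper e_sym e_irr) => //.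
  move=> _ _ /imsetP[k _ ->] /imsetP[k' _ ->]; apply/negP => /adj[w nw eqw].
  by case: (indep nw (esym eqw)).
move=> cT n n_gt0 perT cX arrT neqT.
have cK i : exists k, pr (d k) == cT i by have /imsetP[k _ ->] := cX i; exists k.
pose c i := xchoose (cK i); have cE i : pr (d (c i)) = cT i by apply/eqP/(xchooseP (cK i)).
have per i : c (i + n)%N = c i by apply: inj; rewrite !cE perT.
have arr i : arrow (c i.+1) (c i).
  have /adj[w nw eqw] : e (pr (d (c i))) (mate M (cT i.+1)) by rewrite cE.
  by exists w => //; rewrite -eqw (pr_plane_mate cov (mate_adj e_sym e_irr pM)) cE.
have neq i : c i != c i.+1 by apply: contra (neqT i) => /eqP eqc; rewrite -!cE eqc.
have [/existsP[j Zj]|none] := boolP [exists j : 'I_n, Z (c j)].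
  have ex : exists k, (0 < k)%N && Z (c (j + k)%N) by exists n; rewrite n_gt0 per.
  case: (ex_minnP ex) => k /andP[k_gt0 Zk] min.
  apply: (no_return (c := fun i => c (j + i)%N) k_gt0); rewrite ?addn0 // => i.
  - case/andP=> i_gt0 ltik; apply: contraL ltik => Zi; rewrite -leqNgt.
    by apply: min; rewrite i_gt0.
  - by rewrite addnS.
  - by rewrite addnS.
have nZ i : ~~ Z (c i).
  have -> : c i = c (i %% n)%N.
    rewrite {1}(divn_eq i n) addnC; elim: (i %/ n)%N => [|q IH]; first by rewrite addn0.
    by rewrite mulSn addnCA addnC per.
  apply: contra none => Zi; apply/existsP.
  by exists (Ordinal (ltn_pmod i n_gt0)).
have back k : iter k (leap m) (d (c k)) = d (c 0%N).
  elim: k => // k IH; rewrite iterSr -(straight (neq k)) ?nZ //.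
have muK := mateK e_sym e_irr pM; have mu_adj := mate_adj e_sym e_irr pM.
apply: (@leap_aperiodic m _ _ (d (c 0%N)) n n_gt0).
- exact: (plane_mateK cov).
- exact: plane_mate_nbr.
by rewrite -[in LHS](per 0) add0n back.
Qed.

End CoverUpper.

(** * Upper bounds *)

Lemma mult_lt2 (a : nat) (k : int) : `|a%:Z * k| < 2 * a%:Z -> [\/ k = -1, k = 0 | k = 1].
Proof.
move=> lt2; have lek : `|k| < 2 by nia.
have [?|[?|?]] : k = -1 \/ k = 0 \/ k = 1 by lia.
- exact: Or31.
- exact: Or32.
- exact: Or33.
Qed.

Section Product.
Variables (T : finType) (e : rel T) (pr : int * int -> T) (g L : nat).
Hypotheses (e_sym : symmetric e) (e_irr : irreflexive e) (cov : covers e pr g L 0).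
Hypotheses (g_gt1 : (1 < g)%N) (L_gt2 : (2 < L)%N) (oddL : odd L).
Variable M : {set {set T}}.
Hypothesis pM : perfect_matching e M.

(* The first used column is one step out of phase with the others, which blocks
   horizontal winding; vertical winding is blocked as L is odd. *)
Definition prod_pt (k : 'I_g * 'I_(L./2)) : int * int :=
  (2 * k.1%:Z + 1, 2 * k.2%:Z + (k.1 == 0%N :> nat)%:Z).

Lemma prod_common k k' v w : nbr (prod_pt k) v -> nbr (prod_pt k') w -> pr v = pr w ->
  k = k' \/ prod_pt k = (w.1 * 2 - (prod_pt k').1, w.2 * 2 - (prod_pt k').2).
Proof.
case: k => i j; case: k' => i' j'; have [_ ker _] := cov.
have := ltn_ord i; have := ltn_ord i'; have := ltn_ord j; have := ltn_ord j'.
move=> ltj' ltj lti' lti nv nw /ker[u [t [h1 h2]]].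
move: nv nw; rewrite /nbr /prod_pt /= => nv nw.
have /mult_lt2 u1 : `|g%:Z * u| < 2 * g%:Z by move: h1 nv nw; lia.
have /mult_lt2 t1 : `|L%:Z * t| < 2 * L%:Z by move: h2 nv nw; lia.
have [eqi|nei] := eqVneq i i'.
  have [eqj|nej] := eqVneq (j : nat) j'.
    by left; rewrite eqi; congr (_, _); apply: val_inj.
  right; rewrite eqi in nv h1 *; congr (_, _); case: u1 => eu; case: t1 => et; rewrite eu et in h1 h2; lia.
have nei' : (i : nat) <> i' by move=> E; move/eqP: nei; apply; apply: val_inj.
right; congr (_, _); case: u1 => eu; case: t1 => et; rewrite eu et in h1 h2; lia.
Qed.

Lemma forcing_product : (forcing_number e M + g * L./2 <= #|M|)%N.
Proof.
have [_ ker _] := cov.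
have -> : (g * L./2)%N = #|{: 'I_g * 'I_(L./2)}| by rewrite card_prod !card_ord.
apply: (@forcing_cover _ _ pr g L 0 e_sym e_irr cov _ L_gt2 (or_introl g_gt1) M pM _
  prod_pt pred0) => //; first exact: ltnW.
- move=> [i j] [i' j'] /ker[u [t []]]; rewrite /prod_pt /= => h1 h2.
  have := ltn_ord i; have := ltn_ord i'; have := ltn_ord j; have := ltn_ord j'.
  move=> ltj' ltj lti' lti.
  have /mult_lt2 u1 : `|g%:Z * u| < 2 * g%:Z by lia.
  have /mult_lt2 t1 : `|L%:Z * t| < 2 * L%:Z by lia.
  have ei : (i : nat) = i' by case: u1 => eu; rewrite eu in h1; lia.
  have ej : (j : nat) = j' by rewrite ei in h2; case: t1 => et; rewrite et in h2; lia.
  by congr (_, _); apply: val_inj.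
- move=> [i j] [i' j'] v nv /ker[u [t []]].
  move: nv; rewrite /nbr /prod_pt /= => nv h1 h2.
  have := ltn_ord i; have := ltn_ord i'; have := ltn_ord j; have := ltn_ord j'.
  move=> ltj' ltj lti' lti.
  have /mult_lt2 u1 : `|g%:Z * u| < 2 * g%:Z by lia.
  have /mult_lt2 t1 : `|L%:Z * t| < 2 * L%:Z by lia.
  have ei : (i : nat) = i' by case: u1 => eu; rewrite eu in h1; lia.
  by rewrite ei in h1 h2 nv; case: t1 => et; rewrite et in h2; lia.
- move=> k k' nek _ _ [w nw eqw].
  have [eqk|->] := prod_common nw (plane_mate_nbr _ _ _) eqw; first by rewrite eqk eqxx in nek.
  by rewrite /leap.
Qed.

End Product.

Section Clash.
Variables (T : finType) (pr : int * int -> T) (K : finType) (d : K -> int * int) (z : K).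

(* z is (0, 0), the left end of the shifted row; seen across the seam, the vertices
   of X near z are those congruent to (-1, 1) and (-1, -1). *)
Definition clash (w : int * int) (k : K) : Prop :=
  (d k).2 <> 0 /\ exists2 sg : int, sg = 1 \/ sg = -1 &
    pr (d k) = pr (-1, sg) /\ (w = (-1, 0) \/ w = (0, sg)).

Definition nearly_straight : Prop := forall k k' v w,
  nbr (d k) v -> nbr (d k') w -> pr v = pr w ->
  [\/ k = k', d k = (w.1 * 2 - (d k').1, w.2 * 2 - (d k').2),
      k' = z /\ clash w k | k = z /\ clash v k'].

End Clash.

Section Pointing.
Variables (T : finType) (e : rel T) (pr : int * int -> T) (g L : nat) (s : int).
Hypotheses (e_sym : symmetric e) (e_irr : irreflexive e) (cov : covers e pr g L s).
Hypotheses (g_gt0 : (0 < g)%N) (L_gt2 : (2 < L)%N).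
Hypothesis thick : (1 < g)%N \/ ~~ (L%:Z %| s)%Z.
Variable M : {set {set T}}.
Hypothesis pM : perfect_matching e M.
Let m := plane_mate pr (mate M).

Variables (K : finType) (d : K -> int * int) (z : K).
Hypothesis inj : injective (fun k => pr (d k)).
Hypothesis indep : forall k k' w, nbr (d k) w -> pr w <> pr (d k').
Hypothesis dz : d z = (0, 0).
Hypothesis row : forall k, ((d k).1 %% 2 = 0)%Z <-> (d k).2 = 0.
Hypothesis pos : forall k, exists x : nat, (d k).1 = x%:Z.
Hypothesis near : nearly_straight pr d z.

Let mK : involutive m.
Proof. by apply: (plane_mateK cov) => //; [exact: mate_adj | exact: mateK]. Qed.

Lemma straight_off k k' : k != k' -> ~~ pred1 z k -> ~~ pred1 z k' -> arrow pr M d k' k ->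
  d k = leap m (d k').
Proof.
move=> nek /= nz nz' [v nv eqv].
case: (near nv (plane_mate_nbr _ _ _) eqv) => [E|->|[E _]|[E _]] //.
- by rewrite E eqxx in nek.
- by rewrite E eqxx in nz'.
- by rewrite E eqxx in nz.
Qed.

(* If the partner of z points into the shifted row, an alternating path leaving z
   stays in that row and cannot come back. *)
Lemma forcing_pointing : m (0, 0) = (1, 0) -> (forcing_number e M + #|K| <= #|M|)%N.
Proof.
move=> mz; apply: (@forcing_cover _ _ pr g L s e_sym e_irr cov g_gt0 L_gt2 thick M pM
  _ d (pred1 z)) => //; first exact: straight_off.
move=> c n n_gt0 /eqP c0 /eqP cn nz arr neq.
have stay i : (d (c i.+1)).2 = 0 -> c i != z -> (d (c i)).2 = 0.
  move=> row' nzi; have [v nv eqv] := arr i.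
  have := plane_mate_nbr pr (mate M) (d (c i.+1)); rewrite -/m in eqv *.
  case: (near nv (plane_mate_nbr _ _ _) eqv) => [E|E|[E [_ [sg _ [_]]]]|[E _]].
  - by have := neq i; rewrite E eqxx.
  - have := row (c i); have := row (c i.+1); rewrite E -/m /nbr /=; lia.
  - by rewrite E dz -/m mz => -[] /(congr1 fst) /=; lia.
  - by rewrite E eqxx in nzi.
have down i : (i < n)%N -> (d (c (n - i)%N)).2 = 0.
  elim: i => [|i IH] ltin; first by rewrite subn0 cn dz.
  apply: stay; last by apply: nz; lia.
  have -> : (n - i.+1).+1 = (n - i)%N by lia.
  by apply: IH; lia.
have row1 : (d (c 1%N)).2 = 0 by have := down n.-1; rewrite -subn1 subKn //; apply; lia.
have [v nv eqv] := arr 0%N.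
have n1 : c 1%N != z by have := neq 0%N; rewrite c0 eq_sym.
case: (near nv (plane_mate_nbr _ _ _) eqv) => [E|E|[E _]|[_ [E _]]].
- by have := neq 0%N; rewrite E eqxx.
- have := plane_mate_nbr pr (mate M) (d (c 1%N)); have [x ex] := pos (c 1%N); have := congr1 fst E.
  have := congr1 snd E; rewrite c0 dz -/m /nbr /= row1 => e2 e1 nm.
  have em : m (d (c 1%N)) = m (0, 0) by rewrite mz [LHS]surjective_pairing; congr (_, _); lia.
  by have := can_inj mK em; move: e1; rewrite em mz => e1 ed; move: e1; rewrite ed /=; lia.
- by rewrite E eqxx in n1.
- by rewrite row1 in E.
Qed.

End Pointing.

Section EvenHeight.
Variables (T : finType) (e : rel T) (pr : int * int -> T) (g L : nat) (s : int).
Hypotheses (cov : covers e pr g L s).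
Hypotheses (g_gt0 : (0 < g)%N) (L_gt2 : (2 < L)%N) (evenL : ~~ odd L) (odds : (s %% 2 = 1)%Z).

(* Row 0 is the shifted one. *)
Definition even_pt (k : 'I_g * 'I_(L./2)) : int * int :=
  (2 * k.1%:Z + (k.2 != 0%N :> nat)%:Z, 2 * k.2%:Z).

Lemma even_inj : injective (fun k => pr (even_pt k)).
Proof.
have [_ ker _] := cov.
move=> [i j] [i' j'] /ker[u [t []]]; rewrite /even_pt /= => h1 h2.
have := ltn_ord i; have := ltn_ord i'; have := ltn_ord j; have := ltn_ord j'.
move=> ltj' ltj lti' lti.
have /mult_lt2 u1 : `|g%:Z * u| < 2 * g%:Z by lia.
have u0 : u = 0 by case: u1 => eu //; rewrite eu in h1; lia.
rewrite u0 mul0r subr0 in h1 h2.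
have /mult_lt2 t1 : `|L%:Z * t| < 2 * L%:Z by lia.
have ej : (j : nat) = j' by case: t1 => et; rewrite et in h2; lia.
have ei : (i : nat) = i' by lia.
by congr (_, _); apply: val_inj.
Qed.

Let even_mult (t : int) : exists q : int, t * L%:Z = 2 * q.
Proof.
exists (t * (L./2)%:Z); have -> : L%:Z = 2 * (L./2)%:Z by lia.
by rewrite mulrCA.
Qed.

Lemma even_indep k k' w : nbr (even_pt k) w -> pr w <> pr (even_pt k').
Proof.
have [_ ker _] := cov; case: k k' => i j [i' j'] nw /ker[u [t []]].
move: nw; rewrite /nbr /even_pt /= => nw h1 h2.
have := ltn_ord i; have := ltn_ord i'; have := ltn_ord j; have := ltn_ord j'.
move=> ltj' ltj lti' lti.
have /mult_lt2 u1 : `|g%:Z * u| < 2 * g%:Z by lia.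
case: u1 => eu.
- by have [q eq] := even_mult t; rewrite eq eu in h1 h2; lia.
- rewrite eu mul0r subr0 in h1 h2.
  have /mult_lt2 t1 : `|L%:Z * t| < 2 * L%:Z by lia.
  by case: t1 => et; rewrite et in h2; lia.
- by have [q eq] := even_mult t; rewrite eq eu in h1 h2; lia.
Qed.

Lemma even_row k : ((even_pt k).1 %% 2 = 0)%Z <-> (even_pt k).2 = 0.
Proof. by rewrite /even_pt /=; lia. Qed.

Lemma even_pos k : exists x : nat, (even_pt k).1 = x%:Z.
Proof. by eexists; rewrite /even_pt /= -PoszM -PoszD. Qed.

Lemma even_near (z : 'I_g * 'I_(L./2)) : even_pt z = (0, 0) -> nearly_straight pr even_pt z.
Proof.
have [_ ker _] := cov; move=> dz k k' v w nv nw /ker[u [t [h1 h2]]].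
have isz k0 : (even_pt k0).1 = 0 -> (even_pt k0).2 = 0 -> k0 = z.
  move=> e1 e2; apply: even_inj; rewrite dz; congr pr.
  by rewrite [LHS]surjective_pairing e1 e2.
have := isz k; have := isz k'; clear isz.
case: k k' nv nw => i j [i' j']; rewrite /nbr /even_pt /= => nv nw isz' isz.
have := ltn_ord i; have := ltn_ord i'; have := ltn_ord j; have := ltn_ord j'.
move=> ltj' ltj lti' lti.
have /mult_lt2 u1 : `|g%:Z * u| < 2 * g%:Z by lia.
case: u1 => eu.
- have [q eq] := even_mult t; rewrite eu in h1 h2; apply: Or44; split; first by apply: isz; lia.
  split; first by rewrite /even_pt /=; lia.
  exists (v.2 - (w.2 - 2 * j'%:Z)); first by lia.
  split; last first.
    have [ew|ew] : v.1 = -1 /\ v.2 = 0 \/ v.1 = 0 /\ v.2 = v.2 - (w.2 - 2 * j'%:Z) by lia.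
      by left; rewrite [LHS]surjective_pairing; congr (_, _); lia.
    by right; rewrite [LHS]surjective_pairing; congr (_, _); lia.
  by apply/ker; exists 1, (- t); rewrite /even_pt /=; split; lia.
- rewrite eu mul0r subr0 mulr0 in h1 h2.
  have /mult_lt2 t1 : `|L%:Z * t| < 2 * L%:Z by lia.
  have et : t = 0 by case: t1 => et //; rewrite et in h2; lia.
  rewrite et in h2; have [eqij|neij] := eqVneq (i, j) (i', j'); first exact: Or41.
  have neij' : (i : nat) = i' -> (j : nat) <> j'.
    by move=> ei ej; case/eqP: neij; congr (_, _); apply: val_inj.
  by apply: Or42; rewrite /even_pt /=; congr (_, _); lia.
- have [q eq] := even_mult t; rewrite eu in h1 h2; apply: Or43; split; first by apply: isz'; lia.
  split; first by rewrite /even_pt /=; lia.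
  exists (w.2 - (v.2 - 2 * j%:Z)); first by lia.
  split; last first.
    have [ew|ew] : w.1 = -1 /\ w.2 = 0 \/ w.1 = 0 /\ w.2 = w.2 - (v.2 - 2 * j%:Z) by lia.
      by left; rewrite [LHS]surjective_pairing; congr (_, _); lia.
    by right; rewrite [LHS]surjective_pairing; congr (_, _); lia.
  by apply/ker; exists 1, t; rewrite /even_pt /=; split; lia.
Qed.

Hypotheses (e_sym : symmetric e) (e_irr : irreflexive e).
Variable M : {set {set T}}.
Hypothesis pM : perfect_matching e M.
Let m := plane_mate pr (mate M).

Let thick : (1 < g)%N \/ ~~ (L%:Z %| s)%Z.
Proof.
right; apply/negP => /dvdzP[t es]; have [q eq] := even_mult t.
by move: es odds; rewrite eq; lia.
Qed.

Let half_gt0 : (0 < L./2)%N. Proof. by lia. Qed.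
Let z : 'I_g * 'I_(L./2) := (Ordinal g_gt0, Ordinal half_gt0).
Let dz : even_pt z = (0, 0). Proof. by []. Qed.

Lemma forcing_even_pointing : m (0, 0) = (1, 0) -> (forcing_number e M + g * L./2 <= #|M|)%N.
Proof.
move=> mz; have -> : (g * L./2)%N = #|{: 'I_g * 'I_(L./2)}| by rewrite card_prod !card_ord.
apply: (@forcing_pointing _ _ pr g L s e_sym e_irr cov g_gt0 L_gt2 thick M pM _ even_pt z) => //.
- exact: even_inj.
- exact: even_indep.
- exact: even_row.
- exact: even_pos.
- exact: even_near.
Qed.

(* Here z only joins two vertices of X that are consecutive for leap anyway, so
   it can be bypassed. *)
Lemma forcing_even_vertical : (forall v, (m v).1 = v.1) ->
  m (0, 0) = (0, 1) -> m (-1, 0) = (-1, -1) -> (forcing_number e M + g * L./2 <= #|M|)%N.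
Proof.
move=> ver mz ml; have -> : (g * L./2)%N = #|{: 'I_g * 'I_(L./2)}| by rewrite card_prod !card_ord.
have [_ ker _] := cov; have near := even_near dz.
have muK := mateK e_sym e_irr pM; have mu_adj := mate_adj e_sym e_irr pM.
have mK : involutive m by apply: (plane_mateK cov).
have straight k k' : k != k' -> ~~ pred1 z k -> ~~ pred1 z k' -> arrow pr M even_pt k' k ->
  even_pt k = leap m (even_pt k').
  exact: (straight_off near).
apply: (@forcing_cover _ _ pr g L s e_sym e_irr cov g_gt0 L_gt2 thick M pM _ even_pt (pred1 z)) => //.
- exact: even_inj.
- exact: even_indep.
move=> c n n_gt0 /eqP c0 /eqP cn nz arr neq.
have n_gt1 : (1 < n)%N.
  case: n n_gt0 cn {nz} => [//|[|//]] _ c1.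
  by have := neq 0%N; rewrite c0 c1 eqxx.
have c1z : c 1%N != z by have := neq 0%N; rewrite c0 eq_sym.
have [c' ec'] : exists c', c' = c n.-1 by exists (c n.-1).
have cz : c' != z by have := neq n.-1; rewrite prednK // cn ec'.
have odd_pt k : k != z -> (even_pt k).2 = 0 -> (even_pt k).1 <> 0.
  move=> nk e2 e1; case/eqP: nk; apply: even_inj; congr pr.
  by rewrite dz [LHS]surjective_pairing e1 e2.
have below : pr (even_pt c') = pr (-1, 1).
  have := arr n.-1; rewrite prednK // cn -ec' => -[v nv eqv].
  case: (near _ _ _ _ nv (plane_mate_nbr _ _ _) eqv) => [E|E|[_ [_ [sg sg1 [-> ew]]]]|[E _]].
  - by rewrite E eqxx in cz.
  - have := even_row c'; rewrite E dz -/m mz /=; lia.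
  - congr (pr (_, _)); move: ew; rewrite dz -/m mz.
    by case=> [/(congr1 fst)|/(congr1 snd)] /=; lia.
  - by rewrite E eqxx in cz.
have above : pr (even_pt (c 1%N)) = pr (-1, -1).
  have [v nv eqv] := arr 0%N; rewrite c0 -/m in nv eqv.
  case: (near _ _ _ _ nv (plane_mate_nbr _ _ _) eqv) => [E|E|[E _]|[_ [_ [sg sg1 [E ew]]]]].
  - by rewrite -E eqxx in c1z.
  - have := ver (even_pt (c 1%N)); have := even_row (c 1%N).
    have := plane_mate_nbr pr (mate M) (even_pt (c 1%N)).
    have := congr1 fst E; have := congr1 snd E; rewrite dz -/m /nbr /=; lia.
  - by rewrite E eqxx in c1z.
  - have e1 : pr (m v) = pr (-1, sg).
      by rewrite (pr_plane_mate cov) // eqv -(pr_plane_mate cov) // -/m mK E.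
    case: ew => ev; last first.
      by have /ker[u [t [h1 _]]] := e1; move: h1; rewrite ver ev /=; lia.
    move: e1; rewrite ev ml E => /ker[u [t [/= h1 h2]]].
    case: sg1 h2 => -> //= h2; exfalso.
    have u0 : u = 0 by have : g%:Z * u = 0 by [lia]; move/eqP; rewrite mulf_eq0; lia.
    have /mult_lt2 t1 : `|L%:Z * t| < 2 * L%:Z by rewrite u0 in h2; lia.
    by rewrite u0 in h2; case: t1 => et; rewrite et in h2; lia.
have up : leap m (even_pt (c 1%N)) = even_pt c'.
  have ml' : m (-1, -1) = (-1, 0) by rewrite -ml mK.
  have step x : pr x = pr (-1, -1) -> leap m x = (x.1, x.2 + 2).
    move=> /(plane_mate_pr cov mu_adj g_gt0 L_gt2 thick)[]; rewrite -/m ml' /leap /= => m1 m2.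
    by congr (_, _); lia.
  rewrite step //.
  have /ker[u [t [h1 h2]]] := above; have /ker[u' [t' [h3 h4]]] := below.
  have row1 := even_row (c 1%N); have row2 := even_row c'.
  move: h1 h2 h3 h4 row1 row2; case: (c 1%N) (c') => i j [i' j']; rewrite /even_pt /=.
  have := ltn_ord i; have := ltn_ord i'; have := ltn_ord j; have := ltn_ord j'.
  move=> ltj' ltj lti' lti h1 h2 h3 h4 row1 row2.
  have u1 : u = 1.
    have /mult_lt2 u1 : `|g%:Z * u| < 2 * g%:Z by clear -h1 lti; lia.
    by clear -h1 lti u1; case: u1 => eu //; rewrite eu in h1; lia.
  have u'1 : u' = 1.
    have /mult_lt2 u'1 : `|g%:Z * u'| < 2 * g%:Z by clear -h3 lti'; lia.
    by clear -h3 lti' u'1; case: u'1 => eu //; rewrite eu in h3; lia.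
  rewrite u1 u'1 in h1 h2 h3 h4.
  clear - u1 u'1 h1 h2 h3 h4 row1 row2 ltj ltj' L_gt2.
  have /mult_lt2 tt : `|L%:Z * (t' - t)| < 2 * L%:Z by lia.
  have et : t' = t.
    by case: tt => et; [have {}et : t' = t - 1 by lia | by lia | have {}et : t' = t + 1 by lia];
      rewrite et in h4; lia.
  by rewrite et in h4; congr (_, _); lia.
have back k : (k < n.-1)%N -> iter k (leap m) (even_pt c') = even_pt (c (n.-1 - k)%N).
  elim: k => [_|k IH ltk]; first by rewrite subn0 ec'.
  have ek : (n.-1 - k)%N = (n.-1 - k.+1).+1 by lia.
  rewrite iterS IH ?(ltnW ltk) // ek; apply/esym/straight.
  - exact: neq.
  - by apply: nz; lia.
  - by apply: nz; lia.
  - exact: arr.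
apply: (@leap_aperiodic m mK (plane_mate_nbr _ _) (even_pt c') n.-1); first by lia.
have := back n.-2; have -> : (n.-1 - n.-2)%N = 1%N by lia.
have -> : n.-1 = n.-2.+1 by lia.
by rewrite iterS => -> //; lia.
Qed.

End EvenHeight.

Lemma strip_cases (g L S i j c i' j' c' ex ey ex' ey' U t : int) :
  (L %% 2 = 1)%Z -> (S %% 2 = 0)%Z -> 3 < S < L ->
  0 <= i < g -> 0 <= i' < g -> 0 <= c <= 1 -> 0 <= c' <= 1 ->
  0 <= 2 * j <= L - 3 -> 0 <= 2 * j' <= L - 3 ->
  ex = 0 /\ (ey = 1 \/ ey = -1) \/ ey = 0 /\ (ex = 1 \/ ex = -1) ->
  ex' = 0 /\ (ey' = 1 \/ ey' = -1) \/ ey' = 0 /\ (ex' = 1 \/ ex' = -1) ->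
  2 * i + c + ex - (2 * i' + c') - ex' = 2 * (g * U) ->
  2 * j + ey - 2 * j' - ey' = L * t - U * S ->
  [\/ U = 0 /\ t = 0,
      U = 1 /\ t = 0 /\ (ex = 1 /\ ex' = -1),
      U = -1 /\ t = 0 /\ (ex = -1 /\ ex' = 1) |
      (U = 1 /\ t = 1 /\ ex - ex' = 1) \/ (U = -1 /\ t = -1 /\ ex' - ex = 1)].
Proof.
move=> oddL evS hS hi hi' hc hc' hj hj' he he' h1 h2.
have U1 : U = -1 \/ U = 0 \/ U = 1.
  have : `|g * U| < 2 * g by clear h2 hj hj'; lia.
  by clear -hi; nia.
have t1 : t = -1 \/ t = 0 \/ t = 1.
  have : `|L * t| < 2 * L by clear h1 hi hi'; case: U1 => [e|[e|e]]; rewrite e in h2; lia.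
  by clear -hS; nia.
case: U1 => [eU|[eU|eU]]; case: t1 => [et|[et|et]]; rewrite eU et in h1 h2.
- by apply: Or44; right; split=> //; split=> //; lia.
- by apply: Or43; split=> //; split=> //; lia.
- by exfalso; lia.
- by exfalso; lia.
- by apply: Or41.
- by exfalso; lia.
- by exfalso; lia.
- by apply: Or42; split=> //; split=> //; lia.
- by apply: Or44; left; split=> //; split=> //; lia.
Qed.

Lemma quo_uniq (S y y' q q' : int) :
  0 <= y < S -> 0 <= y' < S -> y + q * S = y' + q' * S -> q = q' /\ y = y'.
Proof.
move=> hy hy' eqS; have lt1 : `|(q - q') * S| < S by lia.
have e : q - q' = 0 by clear eqS; nia.
by have {}e : q = q' by [lia]; rewrite e in eqS *; lia.
Qed.

Lemma strip_straight (g L S i j q y c i' j' q' y' c' ex ey ex' ey' u t : int) :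
  (L %% 2 = 1)%Z -> (S %% 2 = 0)%Z -> 3 < S < L ->
  0 <= i < g -> 0 <= i' < g ->
  0 <= y < S -> (y %% 2 = 0)%Z -> 0 <= q -> c = 1 /\ y <> 0 \/ c = 0 /\ y = 0 ->
  0 <= y' < S -> (y' %% 2 = 0)%Z -> 0 <= q' -> c' = 1 /\ y' <> 0 \/ c' = 0 /\ y' = 0 ->
  y + q * S = 2 * j -> y' + q' * S = 2 * j' ->
  0 <= 2 * j <= L - 3 -> 0 <= 2 * j' <= L - 3 ->
  ex = 0 /\ (ey = 1 \/ ey = -1) \/ ey = 0 /\ (ex = 1 \/ ex = -1) ->
  ex' = 0 /\ (ey' = 1 \/ ey' = -1) \/ ey' = 0 /\ (ex' = 1 \/ ex' = -1) ->
  2 * i + c + 2 * (g * q) + ex - (2 * i' + c' + 2 * (g * q')) - ex' = 2 * (g * u) ->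
  y + ey - y' - ey' = L * t - u * S ->
  [\/ i = i' /\ j = j',
      2 * i + c + 2 * (g * q) = 2 * i' + c' + 2 * (g * q') + 2 * ex' /\ y = y' + 2 * ey',
      [/\ [/\ i' = 0, j' = 0, q' = 0 & y' = 0], i = g - 1, c = 1, u = 1 + q & ex - ex' = 1] |
      [/\ [/\ i = 0, j = 0, q = 0 & y = 0], i' = g - 1, c' = 1, u = - 1 - q' & ex' - ex = 1]].
Proof.
move=> oddL evS hS hi hi' hy evy hq hc hy' evy' hq' hc' eqj eqj' hj hj' he he' h1 h2.
have [U eU] : exists U, U = u - q + q' by exists (u - q + q').
have {}eU : u = U + q - q' by clear -eU; lia.
have h1' : 2 * i + c + ex - (2 * i' + c') - ex' = 2 * (g * U).
  by rewrite eU in h1; clear -h1; lia.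
have h2' : 2 * j + ey - 2 * j' - ey' = L * t - U * S.
  by rewrite -eqj -eqj'; rewrite eU in h2; clear -h2; lia.
have hc01 : 0 <= c <= 1 by clear -hc; lia.
have hc01' : 0 <= c' <= 1 by clear -hc'; lia.
clear h1 h2.
case: (strip_cases oddL evS hS hi hi' hc01 hc01' hj hj' he he' h1' h2')
  => [[e1 e2]|[e1 [e2 [e3 e4]]]|[e1 [e2 [e3 e4]]]|[[e1 [e2 e3]]|[e1 [e2 e3]]]];
  rewrite e1 e2 in h1' h2'.
- have [[ei ej]|ne] : (i = i' /\ j = j') \/ (i <> i' \/ j <> j') by clear; lia.
    exact: Or41.
  have ycase : y = y' + 2 * ey' /\ q = q'.
    have [e0|[e0|e0]] : j = j' \/ j = j' + 1 \/ j = j' - 1 by clear -h2' he he'; lia.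
    + have [] := @quo_uniq S y y' q q' hy hy' _; first by rewrite eqj eqj' e0.
      move=> eq0 ey0; split=> //.
      have : ey' = 0; last by clear -ey0; lia.
      by clear -h1' h2' e0 ne hc hc' ey0 he he'; lia.
    + have lt2 : y' + 2 < S.
        have [//|y2] : y' + 2 < S \/ y' + 2 = S by clear -hy' evy' evS; lia.
        have [] := @quo_uniq S y 0 q (q' + 1) hy _ _; [by clear -hS; lia | | ].
          by rewrite eqj e0; clear -eqj' y2; lia.
        by move=> _ ey0; clear -ey0 y2 hS h1' h2' e0 hc hc' he he'; lia.
      have [] := @quo_uniq S y (y' + 2) q q' hy _ _; [by clear -hy' lt2; lia | | ].
        by rewrite eqj e0; clear -eqj'; lia.
      by move=> eq0 ey0; split=> //; clear -ey0 h1' h2' e0 he he' hc hc'; lia.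
    + have lt2 : y + 2 < S.
        have [//|y2] : y + 2 < S \/ y + 2 = S by clear -hy evy evS; lia.
        have [] := @quo_uniq S y' 0 q' (q + 1) hy' _ _; [by clear -hS; lia | | ].
          by rewrite eqj'; clear -eqj y2 e0; lia.
        by move=> _ ey0; clear -ey0 y2 hS h1' h2' e0 hc hc' he he'; lia.
      have [] := @quo_uniq S y' (y + 2) q' q hy' _ _; [by clear -hy lt2; lia | | ].
        by rewrite eqj'; clear -eqj e0; lia.
      by move=> eq0 ey0; split=> //; clear -ey0 h1' h2' e0 he he' hc hc'; lia.
  case: ycase => ey0 eq0; apply: Or42; split=> //; rewrite eq0 in eqj *.
  by clear -h1' h2' he he' hc hc' ey0 ne eqj eqj'; lia.
- have [] := @quo_uniq S y' y q' (q + 1) hy' hy _.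
    by rewrite eqj'; clear -eqj h2' he he' e3 e4; lia.
  move=> eq0 ey0; apply: Or42; rewrite eq0 ey0.
  by clear -h1' e3 e4 he he'; lia.
- have [] := @quo_uniq S y y' q (q' + 1) hy hy' _.
    by rewrite eqj; clear -eqj' h2' he he' e3 e4; lia.
  move=> eq0 ey0; apply: Or42; rewrite eq0 ey0.
  by clear -h1' e3 e4 he he'; lia.
- have [ei [ec [ei' ec']]] : i = g - 1 /\ c = 1 /\ i' = 0 /\ c' = 0.
    by clear -h1' e3 hi hi' hc01 hc01'; lia.
  have y0 : y' = 0 by clear -ec' hc'; lia.
  have lt' : 2 * j' < S by clear -h2' hj he he' e3; lia.
  have q0 : q' = 0 by clear -lt' eqj' y0 hS hq'; nia.
  apply: Or43; split=> //; last by rewrite eU e1 q0; clear; lia.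
  by split=> //; rewrite y0 q0 in eqj'; clear -eqj'; lia.
- have [ei [ec [ei' ec']]] : i' = g - 1 /\ c' = 1 /\ i = 0 /\ c = 0.
    by clear -h1' e3 hi hi' hc01 hc01'; lia.
  have y0 : y = 0 by clear -ec' hc; lia.
  have lt' : 2 * j < S by clear -h2' hj' he he' e3; lia.
  have q0 : q = 0 by clear -lt' eqj y0 hS hq; nia.
  apply: Or44; split=> //; last by rewrite eU e1 q0; clear; lia.
  by split=> //; rewrite y0 q0 in eqj; clear -eqj; lia.
Qed.

Lemma strip_indep (g L S i j q y c i' j' q' y' c' ex ey u t : int) :
  (L %% 2 = 1)%Z -> (S %% 2 = 0)%Z -> 3 < S < L ->
  0 <= i < g -> 0 <= i' < g ->
  0 <= y < S -> c = 1 /\ y <> 0 \/ c = 0 /\ y = 0 ->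
  0 <= y' < S -> c' = 1 /\ y' <> 0 \/ c' = 0 /\ y' = 0 ->
  y + q * S = 2 * j -> y' + q' * S = 2 * j' ->
  0 <= 2 * j <= L - 3 -> 0 <= 2 * j' <= L - 3 ->
  ex = 0 /\ (ey = 1 \/ ey = -1) \/ ey = 0 /\ (ex = 1 \/ ex = -1) ->
  2 * i + c + 2 * (g * q) + ex - (2 * i' + c' + 2 * (g * q')) = 2 * (g * u) ->
  y + ey - y' = L * t - u * S -> False.
Proof.
move=> oddL evS hS hi hi' hy hc hy' hc' eqj eqj' hj hj' he h1 h2.
have [U eU] : exists U, U = u - q + q' by exists (u - q + q').
have {}eU : u = U + q - q' by clear -eU; lia.
have h1' : 2 * i + c + ex - (2 * i' + c') = 2 * (g * U).
  by rewrite eU in h1; clear -h1; lia.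
have h2' : 2 * j + ey - 2 * j' = L * t - U * S.
  by rewrite -eqj -eqj'; rewrite eU in h2; clear -h2; lia.
have hc01 : 0 <= c <= 1 by clear -hc; lia.
have hc01' : 0 <= c' <= 1 by clear -hc'; lia.
clear h1 h2.
have U1 : U = -1 \/ U = 0 \/ U = 1.
  have : `|g * U| < 2 * g by clear -h1' hc01 hc01' hi hi' he; lia.
  by clear -hi; nia.
have t1 : t = -1 \/ t = 0 \/ t = 1.
  have : `|L * t| < 2 * L by clear -h2' hj hj' he hS U1; case: U1 => [e|[e|e]]; rewrite e in h2'; lia.
  by clear -hS; nia.
have same : 2 * j = 2 * j' -> c = c'.
  rewrite -eqj -eqj' => /(quo_uniq hy hy')[_ ey0]; clear -hc hc' ey0; lia.
have next : 2 * j' = 2 * j + S -> c = c'.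
  move=> e0; have [] := @quo_uniq S y' y q' (q + 1) hy' hy _.
    by rewrite eqj' e0; clear -eqj; lia.
  by clear -hc hc'; lia.
have prev : 2 * j = 2 * j' + S -> c = c'.
  move=> e0; have [] := @quo_uniq S y y' q (q' + 1) hy hy' _.
    by rewrite eqj e0; clear -eqj'; lia.
  by clear -hc hc'; lia.
clear eqj eqj' eU.
by case: U1 => [eU|[eU|eU]]; case: t1 => [et|[et|et]]; rewrite eU et in h1' h2'; lia.
Qed.

Section OddHeight.
Variables (T : finType) (e : rel T) (pr : int * int -> T) (g L S : nat).
Hypotheses (cov : covers e pr g L S%:Z).
Hypotheses (g_gt0 : (0 < g)%N) (oddL : odd L) (evenS : ~~ odd S) (S_gt3 : (3 < S)%N)
  (ltSL : (S < L)%N).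

(* Row o of the strip of 2g columns is written o = y + q S and placed at height y,
   2gq further to the right: the shifted row y = 0 then runs all along the strip
   0 <= y < S. *)
Definition odd_pt (k : 'I_g * 'I_(L./2)) : int * int :=
  let y := (k.2.*2 %% S)%N in
  (2 * k.1%:Z + (y != 0%N)%:Z + 2 * (g%:Z * (k.2.*2 %/ S)%N%:Z), y%:Z).

Let odd_ptP k : exists i j q y c : int,
  [/\ odd_pt k = (2 * i + c + 2 * (g%:Z * q), y),
      [/\ 0 <= i < g%:Z, 0 <= y < S%:Z, (y %% 2 = 0)%Z, 0 <= q &
          c = 1 /\ y <> 0 \/ c = 0 /\ y = 0],
      y + q * S%:Z = 2 * j, 0 <= 2 * j <= L%:Z - 3 & i = k.1 /\ j = k.2].
Proof.
have := ltn_ord k.1; have := ltn_ord k.2 => ltj lti.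
have y_lt : (k.2.*2 %% S < S)%N by rewrite ltn_mod; lia.
have y_even : ~~ odd (k.2.*2 %% S) by rewrite odd_mod ?odd_double // (negbTE evenS).
exists k.1, k.2, (k.2.*2 %/ S)%N, (k.2.*2 %% S)%N, ((k.2.*2 %% S)%N != 0%N); split=> //.
- by split=> //; clear -lti y_lt y_even; lia.
- by rewrite addrC -PoszM -PoszD -divn_eq -PoszM mul2n.
- by clear -ltj oddL; lia.
Qed.


Let oddL' : (L%:Z %% 2 = 1)%Z. Proof. by clear -oddL; lia. Qed.
Let evenS' : (S%:Z %% 2 = 0)%Z. Proof. by clear -evenS; lia. Qed.
Let hS : 3 < S%:Z < L%:Z. Proof. by clear -S_gt3 ltSL; lia. Qed.

Lemma odd_row k : ((odd_pt k).1 %% 2 = 0)%Z <-> (odd_pt k).2 = 0.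
Proof. by have [i [j [q [y [c [-> [_ _ _ _ hc] _ _ _]]]]]] := odd_ptP k => /=; clear -hc; lia. Qed.

Lemma odd_pos k : exists x : nat, (odd_pt k).1 = x%:Z.
Proof.
exists (2 * k.1 + (k.2.*2 %% S != 0) + 2 * (g * (k.2.*2 %/ S)))%N.
by rewrite !PoszD !PoszM.
Qed.

Lemma odd_common k k' v w : nbr (odd_pt k) v -> nbr (odd_pt k') w -> pr v = pr w ->
  [\/ k = k', odd_pt k = (w.1 * 2 - (odd_pt k').1, w.2 * 2 - (odd_pt k').2),
      [/\ odd_pt k' = (0, 0), (odd_pt k).2 <> 0, pr (odd_pt k) = pr (-1, (odd_pt k).2 - v.2 + w.2)
        & (v.1 - (odd_pt k).1) - w.1 = 1] |
      [/\ odd_pt k = (0, 0), (odd_pt k').2 <> 0, pr (odd_pt k') = pr (-1, (odd_pt k').2 - w.2 + v.2)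
        & (w.1 - (odd_pt k').1) - v.1 = 1]].
Proof.
have [_ ker _] := cov; move=> /nbr_step nv /nbr_step nw /ker[u [t [h1 h2]]].
move: nv nw.
have [i [j [q [y [c [-> [hi hy evy hq hc] eqj hj [ei ej]]]]]]] := odd_ptP k.
have [i' [j' [q' [y' [c' [-> [hi' hy' evy' hq' hc'] eqj' hj' [ei' ej']]]]]]] := odd_ptP k'.
rewrite /= => nv nw.
have h1' : 2 * i + c + 2 * (g%:Z * q) + (v.1 - (2 * i + c + 2 * (g%:Z * q))) -
    (2 * i' + c' + 2 * (g%:Z * q')) - (w.1 - (2 * i' + c' + 2 * (g%:Z * q'))) = 2 * (g%:Z * u).
  by clear -h1; lia.
have h2' : y + (v.2 - y) - y' - (w.2 - y') = L%:Z * t - u * S%:Z by clear -h2; lia.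
case: (strip_straight oddL' evenS' hS hi hi' hy evy hq hc hy' evy' hq' hc' eqj eqj' hj hj'
  nv nw h1' h2') => [[e1 e2]|[e1 e2]|[[e1 e2 e3 e4] e5 e6 e7 e8]|[[e1 e2 e3 e4] e5 e6 e7 e8]].
- apply: Or41; move: ei ej ei' ej'; rewrite e1 e2; case: k k' => a b [a' b'] /= -> -> [ea] [eb].
  by congr (_, _); apply: val_inj.
- by apply: Or42; congr (_, _); [clear -e1 | clear -e2]; lia.
- have ec : c' = 0 by clear -hc' e4; lia.
  apply: Or43; split.
  + by rewrite e1 ec e3 e4; congr (_, _); clear; lia.
  + by clear -hc e6; lia.
  + apply/ker; exists u, t => /=; split; last by clear -h2; lia.
    by rewrite e5 e6 e7; clear; lia.
  + by move: e8; rewrite e1 ec e3; clear; lia.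
- have ec : c = 0 by clear -hc e4; lia.
  apply: Or44; split.
  + by rewrite e1 ec e3 e4; congr (_, _); clear; lia.
  + by clear -hc' e6; lia.
  + apply/ker; exists (- u), (- t) => /=; split; last by clear -h2; lia.
    by rewrite e5 e6 e7; clear; lia.
  + by move: e8; rewrite e1 ec e3; clear; lia.
Qed.

Lemma odd_inj : injective (fun k => pr (odd_pt k)).
Proof.
have [_ ker _] := cov; move=> k k' /= eqp.
have shift a b : pr ((odd_pt k).1 + a, (odd_pt k).2 + b) = pr ((odd_pt k').1 + a, (odd_pt k').2 + b).
  move: (odd_pt k) (odd_pt k') eqp => x x' /ker[u [t [h1 h2]]].
  by apply/ker; exists u, t; rewrite /=; clear -h1 h2; lia.
have nb1 v : nbr v (v.1 + 1, v.2 + 0) by rewrite /nbr /=; clear; lia.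
have nb2 v : nbr v (v.1 + 0, v.2 + 1) by rewrite /nbr /=; clear; lia.
case: (odd_common (nb1 _) (nb1 _) (shift 1 0)) => [//|e1|[-> _ _ /=]|[-> _ _ /=]]; try by clear; lia.
case: (odd_common (nb2 _) (nb2 _) (shift 0 1)) => [//|e2|[-> _ _ /=]|[-> _ _ /=]]; try by clear; lia.
by have := congr1 fst e2; rewrite {1}e1 /=; clear; lia.
Qed.

Lemma odd_indep k k' w : nbr (odd_pt k) w -> pr w <> pr (odd_pt k').
Proof.
have [_ ker _] := cov; move=> /nbr_step nw /ker[u [t [h1 h2]]]; move: nw h1 h2.
have [i [j [q [y [c [-> [hi hy evy hq hc] eqj hj _]]]]]] := odd_ptP k.
have [i' [j' [q' [y' [c' [-> [hi' hy' evy' hq' hc'] eqj' hj' _]]]]]] := odd_ptP k'.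
rewrite /= => nw h1 h2.
apply: (strip_indep (u := u) (t := t) oddL' evenS' hS hi hi' hy hc hy' hc' eqj eqj' hj hj' nw).
  by clear -h1; lia.
by clear -h2; lia.
Qed.

Lemma odd_near (z : 'I_g * 'I_(L./2)) : odd_pt z = (0, 0) -> nearly_straight pr odd_pt z.
Proof.
move=> dz k k' v w nv nw eqvw.
have isz k0 : odd_pt k0 = (0, 0) -> k0 = z by move=> e0; apply: odd_inj; rewrite e0 dz.
have pick_sg (a x : int * int) : nbr a x -> x.1 - a.1 = 0 -> x.2 - a.2 = 1 \/ x.2 - a.2 = -1.
  by rewrite /nbr; clear; lia.
case: (odd_common nv nw eqvw) => [->|e0|[e0 e1 e2 e3]|[e0 e1 e2 e3]].
- exact: Or41.
- exact: Or42.
- apply: Or43; split; first exact: isz.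
  have [nv' nw'] := (nbr_step nv, nbr_step nw); rewrite e0 /= in nw'.
  split=> //; exists ((odd_pt k).2 - v.2 + w.2); first by clear -nv' nw' e3; lia.
  split=> //.
  have [ew|ew] : w.1 = -1 \/ w.1 = 0 by clear -nv' nw' e3; lia.
    by left; rewrite [LHS]surjective_pairing; congr (_, _); clear -nv' nw' e3 ew; lia.
  by right; rewrite [LHS]surjective_pairing; congr (_, _); clear -nv' nw' e3 ew; lia.
- apply: Or44; split; first exact: isz.
  have [nv' nw'] := (nbr_step nv, nbr_step nw); rewrite e0 /= in nv'.
  split=> //; exists ((odd_pt k').2 - w.2 + v.2); first by clear -nv' nw' e3; lia.
  split=> //.
  have [ew|ew] : v.1 = -1 \/ v.1 = 0 by clear -nv' nw' e3; lia.
    by left; rewrite [LHS]surjective_pairing; congr (_, _); clear -nv' nw' e3 ew; lia.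
  by right; rewrite [LHS]surjective_pairing; congr (_, _); clear -nv' nw' e3 ew; lia.
Qed.

Hypotheses (e_sym : symmetric e) (e_irr : irreflexive e).
Variable M : {set {set T}}.
Hypothesis pM : perfect_matching e M.

Lemma forcing_odd_pointing : plane_mate pr (mate M) (0, 0) = (1, 0) ->
  (forcing_number e M + g * L./2 <= #|M|)%N.
Proof.
move=> mz; have -> : (g * L./2)%N = #|{: 'I_g * 'I_(L./2)}| by rewrite card_prod !card_ord.
have half_gt0 : (0 < L./2)%N by clear -S_gt3 ltSL; lia.
have L_gt2 : (2 < L)%N by clear -S_gt3 ltSL; lia.
have thick : (1 < g)%N \/ ~~ (L%:Z %| S%:Z)%Z.
  by right; rewrite dvdzE /= gtnNdvd //; clear -S_gt3; lia.
apply: (@forcing_pointing _ _ pr g L S e_sym e_irr cov g_gt0 L_gt2 thick M pM _ odd_pt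
  (Ordinal g_gt0, Ordinal half_gt0)) => //.
- exact: odd_inj.
- exact: odd_indep.
- by rewrite /odd_pt /= mod0n div0n /=; congr (_, _); clear; lia.
- exact: odd_row.
- exact: odd_pos.
- by apply: odd_near; rewrite /odd_pt /= mod0n div0n /=; congr (_, _); clear; lia.
Qed.

End OddHeight.

Lemma plane_mate_shift (T : finType) (pr : int * int -> T) (mu : T -> T) (a b : int) v :
  plane_mate (fun v => pr (v.1 + a, v.2 + b)) mu v =
  ((plane_mate pr mu (v.1 + a, v.2 + b)).1 - a, (plane_mate pr mu (v.1 + a, v.2 + b)).2 - b).
Proof.
rewrite /plane_mate /= (addrAC _ a 1) (addrAC _ a (- 1)) (addrAC _ b 1).
case: ifP => _; [|case: ifP => _; [|case: ifP => _]] => /=; congr (_, _); clear; lia.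
Qed.

Section Directions.
Variables (T : finType) (e : rel T) (pr : int * int -> T) (g L : nat) (s : int).
Hypotheses (e_sym : symmetric e) (e_irr : irreflexive e) (cov : covers e pr g L s).
Hypotheses (g_gt0 : (0 < g)%N) (L_gt2 : (2 < L)%N).
Hypothesis thick : (1 < g)%N \/ ~~ (L%:Z %| s)%Z.
Variable M : {set {set T}}.
Hypothesis pM : perfect_matching e M.
Let m := plane_mate pr (mate M).

Let mK : involutive m.
Proof. by apply: (plane_mateK cov) => //; [exact: mate_adj | exact: mateK]. Qed.

Let m_pr v w : pr v = pr w -> (m v).1 - v.1 = (m w).1 - w.1 /\ (m v).2 - v.2 = (m w).2 - w.2.
Proof. by apply: (plane_mate_pr cov) => //; exact: mate_adj. Qed.

Lemma right_or_vertical :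
  (exists v, m v = (v.1 + 1, v.2)) \/ (forall v, (m v).1 = v.1).
Proof.
have [sur _ _] := cov.
have ex t : exists v, pr v == t by have [v <-] := sur t; exists v.
have [/forallP all|/forallPn[t nt]] := boolP [forall t, (m (xchoose (ex t))).1 == (xchoose (ex t)).1].
  right=> v; have /m_pr[h _] := eqP (xchooseP (ex (pr v))).
  by move: h; rewrite (eqP (all (pr v))) subrr => /esym/subr0_eq.
left; have {t nt} [v nt] : exists v, (m v).1 != v.1 by exists (xchoose (ex t)).
have nv := plane_mate_nbr pr (mate M) v; rewrite -/m in nv.
have [ev|ev] : (m v).1 = v.1 + 1 /\ (m v).2 = v.2 \/ v.1 = (m v).1 + 1 /\ v.2 = (m v).2.
  by move: nv nt; rewrite /nbr; clear; lia.
  by exists v; case: ev => e1 e2; rewrite [LHS]surjective_pairing e1 e2.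
by exists (m v); rewrite mK; case: ev => <- <-; case: (v).
Qed.

Section Vertical.
Hypothesis ver : forall v, (m v).1 = v.1.

Let up (x y : int) : bool := (m (x, y)).2 == y + 1.

Let up_pr x y x' y' : pr (x, y) = pr (x', y') -> up x y = up x' y'.
Proof. by case/m_pr => _ /=; rewrite /up; clear; lia. Qed.

Let m_up x y : m (x, y) = (x, if up x y then y + 1 else y - 1).
Proof.
have := ver (x, y); have := plane_mate_nbr pr (mate M) (x, y); rewrite -/m /up /nbr.
case: (m (x, y)) => a b /= nb ea; rewrite {}ea in nb *; clear -nb; congr (_, _).
by case: (b =P y + 1) => h; lia.
Qed.

Let up1 x y : up x (y + 1) = ~~ up x y.
Proof.
case ey: (up x y); case ey1: (up x (y + 1)) => //; exfalso.
  have := mK (x, y); rewrite m_up ey m_up ey1 => /(congr1 snd) /=; clear; lia.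
have := mK (x, y + 1); rewrite m_up ey1 addrK m_up ey => /(congr1 snd) /=; clear; lia.
Qed.

Let upn x y (k : nat) : up x (y + k%:Z) = up x y (+) odd k.
Proof.
elim: k => [|k IH]; first by rewrite addr0 addbF.
by rewrite -addn1 PoszD addrA up1 IH addn1 /= addbN.
Qed.

Let upz x y (k : int) : up x (y + k) = up x y (+) odd `|k|.
Proof.
case: k => k; first exact: upn.
have {2}-> : y = y + Negz k + k.+1%:Z by clear; lia.
by rewrite upn -addbA addbb addbF.
Qed.

Lemma vertical_even : ~~ odd L.
Proof.
have [_ ker _] := cov; apply/negP => oddL.
have /up_pr : pr (0, 0 + L%:Z) = pr (0, 0) by apply/ker; exists 0, 1 => /=; clear; lia.
by rewrite upn oddL addbT; case: (up 0 0).
Qed.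

Lemma vertical_step : (s %% 2 = 1)%Z ->
  exists v, m v = (v.1, v.2 + 1) /\ m (v.1 - 1, v.2) = (v.1 - 1, v.2 - 1).
Proof.
move=> odds; have [_ ker _] := cov.
have [y upy] : exists y, up 0 y.
  by case e0: (up 0 0); [exists 0 | exists (0 + 1); rewrite up1 e0].
have [/existsP[k /andP[upk nup]]|/existsPn none] :=
  boolP [exists k : 'I_(2 * g), up (- k%:Z) y && ~~ up (- k%:Z - 1) y].
  by exists (- k%:Z, y); rewrite /= !m_up upk (negbTE nup).
have all k : (k <= 2 * g)%N -> up (- k%:Z) y.
  elim: k => [|k IH] ltk; first by rewrite oppr0.
  have := none (Ordinal ltk); rewrite /= IH ?(ltnW ltk) //= negbK.
  by have -> : - k%:Z - 1 = - k.+1%:Z by clear; lia.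
have := all _ (leqnn _).
have /up_pr-> : pr (- (2 * g)%N%:Z, y) = pr (0, y - s).
  by apply/ker; exists (- 1), 0 => /=; clear; lia.
rewrite upz upy /=; suff -> : odd `|- s| by [].
by clear -odds; lia.
Qed.

End Vertical.
End Directions.

Section Combined.
Variables (T : finType) (e : rel T) (pr : int * int -> T) (g L : nat) (s : int).
Hypotheses (e_sym : symmetric e) (e_irr : irreflexive e) (cov : covers e pr g L s).
Hypotheses (g_gt0 : (0 < g)%N) (L_gt2 : (2 < L)%N).
Variable M : {set {set T}}.
Hypothesis pM : perfect_matching e M.

Lemma forcing_even_height : ~~ odd L -> (s %% 2 = 1)%Z ->
  (forcing_number e M + g * L./2 <= #|M|)%N.
Proof.
move=> evL odds.
have thick : (1 < g)%N \/ ~~ (L%:Z %| s)%Z.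
  right; apply/negP => /dvdzP[t es]; move: odds; rewrite es.
  have -> : L%:Z = 2 * (L./2)%:Z by clear -evL; lia.
  by rewrite mulrCA modzMr.
have [[v mv]|ver] := right_or_vertical e_sym e_irr cov g_gt0 L_gt2 thick pM.
  apply: (forcing_even_pointing (covers_shift v.1 v.2 cov)) => //.
  rewrite plane_mate_shift /= !add0r -surjective_pairing mv /=.
  by congr (_, _); clear; lia.
have [v [mv mv']] := vertical_step e_sym e_irr cov g_gt0 L_gt2 thick pM ver odds.
apply: (forcing_even_vertical (covers_shift v.1 v.2 cov)) => //.
- by move=> w; rewrite plane_mate_shift /= ver /=; clear; lia.
- rewrite plane_mate_shift /= !add0r -surjective_pairing mv /=.
  by congr (_, _); clear; lia.
- rewrite plane_mate_shift /= add0r [-1 + _]addrC mv' /=.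
  by congr (_, _); clear; lia.
Qed.

End Combined.

Section CombinedOdd.
Variables (T : finType) (e : rel T) (g L : nat).
Hypotheses (e_sym : symmetric e) (e_irr : irreflexive e).
Hypotheses (g_gt0 : (0 < g)%N) (L_gt2 : (2 < L)%N) (oddL : odd L).
Variable M : {set {set T}}.
Hypothesis pM : perfect_matching e M.

Lemma forcing_odd_reduced pr (S : nat) : covers e pr g L S -> ~~ odd S -> (3 < S < L)%N ->
  (forcing_number e M + g * L./2 <= #|M|)%N.
Proof.
move=> cov evS /andP[S_gt3 ltSL].
have thick : (1 < g)%N \/ ~~ (L%:Z %| S%:Z)%Z.
  by right; rewrite dvdzE /= gtnNdvd //; clear -S_gt3; lia.
have [[v mv]|ver] := right_or_vertical e_sym e_irr cov g_gt0 L_gt2 thick pM; last first.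
  by have := vertical_even e_sym e_irr cov g_gt0 L_gt2 thick pM ver; rewrite oddL.
apply: (forcing_odd_pointing (covers_shift v.1 v.2 cov)) => //.
rewrite plane_mate_shift /= !add0r -surjective_pairing mv /=.
by congr (_, _); clear; lia.
Qed.

Lemma forcing_odd_height pr (s : int) (p : nat) : covers e pr g L s ->
  (2 < p)%N -> (p %| L)%N -> (p%:Z %| s)%Z -> (1 < g)%N \/ ~~ (L%:Z %| s)%Z ->
  (forcing_number e M + g * L./2 <= #|M|)%N.
Proof.
move=> cov p_gt2 pL ps thick; have {}cov := covers_mod (- (s %/ L%:Z)%Z) cov.
have ltr : (0 <= (s %% L%:Z)%Z < L%:Z).
  by rewrite modz_ge0 ?ltz_pmod //; clear -L_gt2; lia.
have er : s + - (s %/ L%:Z)%Z * L%:Z = (s %% L%:Z)%Z by rewrite {1}(divz_eq s L) mulNr addrAC subrr add0r.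
have pr' : (p%:Z %| (s %% L%:Z)%Z)%Z.
  by rewrite -er rpredD // mulNr rpredN dvdz_mull.
have Lr : (L%:Z %| s)%Z = ((s %% L%:Z)%Z == 0) by apply/dvdz_mod0P/eqP.
rewrite er in cov; rewrite {}Lr in thick.
have [k ek] : exists k : nat, (s %% L%:Z)%Z = k%:Z by case: (s %% L%:Z)%Z ltr => // k; exists k.
rewrite {}ek in cov ltr pr' thick; clear er ps s.
have {pr'} pk : (p %| k)%N by [].
have ltk : (k < L)%N by clear -ltr; lia.
have [k0|k_gt0] := posnP k.
  rewrite k0 in cov thick; case: thick => [g_gt1|//].
  exact: (forcing_product e_sym e_irr cov).
have no2 l : (p %| l)%N -> (0 < l)%N -> ~~ odd l -> (3 < l)%N.
  move=> pl l0 evl; have := dvdn_leq l0 pl; have : l != 3 by apply: contraNneq evl => ->.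
  by clear -p_gt2; lia.
have [oddk|evk] := boolP (odd k); last first.
  by apply: (forcing_odd_reduced cov evk); rewrite ltk no2.
have := covers_mod 1 (covers_flip cov).
have -> : - k%:Z + 1 * L%:Z = (L - k)%N%:Z by clear -ltk; lia.
move=> /forcing_odd_reduced; apply; first by clear -oddL oddk ltk; lia.
rewrite no2 ?dvdn_sub ?subn_gt0 //; last by clear -oddL oddk ltk; lia.
by clear -k_gt0 L_gt2; lia.
Qed.

End CombinedOdd.

(** * The quadriculated torus *)

Lemma intr_Zp_eq0 (q : nat) (a : int) : (1 < q)%N -> (a%:~R == 0 :> 'Z_q) = (q%:Z %| a)%Z.
Proof.
move=> q_gt1.
have nat_case (k : nat) : (k%:R == 0 :> 'Z_q) = (q %| k)%N.
  by rewrite -val_eqE /= val_Zp_nat // /dvdn.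
rewrite dvdzE absz_nat; case: a => k; first by rewrite -nat_case.
by rewrite NegzE mulrNz oppr_eq0 -nat_case abszN.
Qed.

Lemma intr_Zp_eq (q : nat) (a b : int) : (1 < q)%N ->
  (a%:~R = b%:~R :> 'Z_q) <-> (q%:Z %| a - b)%Z.
Proof.
move=> q_gt1; rewrite -intr_Zp_eq0 // rmorphB subr_eq0.
by split=> /eqP.
Qed.

Section TorusCover.
Variables (p q s : nat).
Hypotheses (p_gt1 : (1 < p)%N) (q_gt1 : (1 < q)%N).

Let modp_lt (y : int) : (`|(y %% p%:Z)%Z| < p)%N.
Proof. by have := ltz_pmod y (_ : 0 < p%:Z); have := modz_ge0 y (_ : p%:Z != 0); clear -p_gt1; lia. Qed.

Definition torus_pr (v : int * int) : torus_vertex p q :=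
  (Ordinal (modp_lt v.2), (v.1 + s%:Z * (v.2 %/ p%:Z)%Z)%:~R).

Let p_neq0 : p%:Z != 0. Proof. by clear -p_gt1; lia. Qed.

Let modzE (d k : int) : 0 <= k < p%:Z ->
  ((d * p%:Z + k) %% p%:Z)%Z = k /\ ((d * p%:Z + k) %/ p%:Z)%Z = d.
Proof.
by move=> hk; rewrite modzMDl divzMDl // modz_small ?divz_small ?addr0.
Qed.

Let split_row (y : int) : exists d k : int, y = d * p%:Z + k /\ 0 <= k < p%:Z.
Proof.
exists (y %/ p%:Z)%Z, (y %% p%:Z)%Z; split; first exact: divz_eq.
by rewrite modz_ge0 //= ltz_pmod //; clear -p_gt1; lia.
Qed.

Let torus_prE (x d k : int) : 0 <= k < p%:Z ->
  nat_of_ord (torus_pr (x, d * p%:Z + k)).1 = `|k|%N /\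
  (torus_pr (x, d * p%:Z + k)).2 = (x + s%:Z * d)%:~R.
Proof. by move=> hk; have [em ed] := modzE d hk; rewrite /torus_pr /= em ed. Qed.

Lemma torus_pr_eq v w : torus_pr v = torus_pr w <->
  exists k : int, v.2 - w.2 = p%:Z * k /\ (q%:Z %| v.1 - w.1 + s%:Z * k)%Z.
Proof.
case: v w => x y [x' y'] /=.
have [d [k [-> hk]]] := split_row y; have [d' [k' [-> hk']]] := split_row y'.
have [e1 e2] := torus_prE x d hk; have [e1' e2'] := torus_prE x' d' hk'.
split=> [eqp|[l [el dv]]].
  exists (d - d'); have ek : k = k'.
    by move: (congr1 (fun t => nat_of_ord t.1) eqp); rewrite e1 e1'; clear -hk hk'; lia.
  split; first by rewrite ek; clear; lia.
  have /(intr_Zp_eq _ _ q_gt1) : (x + s%:Z * d)%:~R = (x' + s%:Z * d')%:~R :> 'Z_q.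
    by rewrite -e2 -e2' eqp.
  by congr (_ %| _)%Z; clear; lia.
have [ek ed] : k = k' /\ d = d' + l.
  have [] := @quo_uniq p%:Z k k' d (d' + l) hk hk' _; last by move=> -> ->.
  by clear -el; lia.
rewrite [LHS]surjective_pairing [RHS]surjective_pairing e2 e2'; congr (_, _).
  by apply: val_inj; rewrite /= in e1 e1' *; rewrite e1 e1' ek.
apply/intr_Zp_eq => //; move: dv; congr (_ %| _)%Z.
by rewrite ed; clear; lia.
Qed.

Lemma torus_pr_surj t : exists v, torus_pr v = t.
Proof.
case: t => i j; exists (j%:Z, 0 * p%:Z + i%:Z).
have [] := @torus_prE j 0 i _; first by have := ltn_ord i; clear; lia.
move=> e1 e2; rewrite [LHS]surjective_pairing e2; congr (_, _); first exact: val_inj.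
by rewrite mulr0 addr0 [LHS]natr_Zp.
Qed.

Let torus_pr_shift v w a b : torus_pr v = torus_pr w ->
  torus_pr (v.1 + a, v.2 + b) = torus_pr (w.1 + a, w.2 + b).
Proof.
move/torus_pr_eq=> [k [ek dk]]; apply/torus_pr_eq; exists k; split; first by rewrite /= -ek; clear; lia.
by move: dk; congr (_ %| _)%Z; rewrite /=; clear; lia.
Qed.

Let torus_right v : torus p q s (torus_pr v) (torus_pr (v.1 + 1, v.2)).
Proof.
rewrite /torus /torus_arc /=.
have -> : (v.1 + 1 + s%:Z * (v.2 %/ p%:Z)%Z)%:~R = (v.1 + s%:Z * (v.2 %/ p%:Z)%Z)%:~R + 1 :> 'Z_q.
  by rewrite addrAC rmorphD.
by rewrite -val_eqE !eqxx.
Qed.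

Let torus_up v : torus p q s (torus_pr v) (torus_pr (v.1, v.2 + 1)).
Proof.
case: v => x y /=; have [d [k [-> hk]]] := split_row y; have [e1 e2] := torus_prE x d hk.
have [ltk|ek] : 0 <= k + 1 < p%:Z \/ k = p%:Z - 1 by clear -hk; lia.
  have [e1' e2'] := torus_prE x d ltk; rewrite -addrA.
  rewrite /torus /torus_arc e1 e1' e2 e2' eqxx andbT.
  by have -> : `|(k + 1)%R|%N = (`|k|%N).+1 by [clear -hk; lia]; rewrite eqxx orbT.
have h0 : 0 <= (0 : int) < p%:Z by clear -p_gt1; lia.
have [e1' e2'] := torus_prE x (d + 1) h0.
have -> : d * p%:Z + k + 1 = (d + 1) * p%:Z + 0 by rewrite ek; clear; lia.
rewrite /torus /torus_arc e1 e1' e2 e2'; apply/orP; right; apply/orP; right; apply/orP; right.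
rewrite eqxx /=; apply/andP; split; first by rewrite ek; clear -p_gt1; lia.
by rewrite mulrDr mulr1 addrA [X in _ == X - _]rmorphD /= addrK.
Qed.

Let torus_arc_nbr v t : torus_arc s (torus_pr v) t -> exists2 w, nbr v w & t = torus_pr w.
Proof.
case: v => x y; have [d [k [-> hk]]] := split_row y; have [e1 e2] := torus_prE x d hk.
case/or3P=> [/andP[/eqP h1 /eqP h2]|/andP[/eqP h1 /eqP h2]|/and3P[/eqP h0 /eqP h1 /eqP h2]].
- exists (x + 1, d * p%:Z + k); first by rewrite /nbr /=; clear; lia.
  rewrite [LHS]surjective_pairing h1 h2 e2 [RHS]surjective_pairing; congr (_, _).
  by have [_ ->] := torus_prE (x + 1) d hk; rewrite addrAC [RHS]rmorphD.
- have ltk : 0 <= k + 1 < p%:Z by have := ltn_ord t.1; rewrite h1 e1; clear -hk; lia.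
  have [e1' e2'] := torus_prE x d ltk.
  exists (x, d * p%:Z + (k + 1)); first by rewrite /nbr /=; clear; lia.
  rewrite [LHS]surjective_pairing h2 e2 [RHS]surjective_pairing e2'; congr (_, _).
  by apply: val_inj; rewrite /= in e1' *; rewrite e1' [LHS]h1 e1; clear -hk; lia.
- have k0 : k = 0 by rewrite e1 in h0; clear -h0; lia.
  have lt1 : 0 <= p%:Z - 1 < p%:Z by clear -p_gt1; lia.
  have [e1' e2'] := torus_prE x (d - 1) lt1.
  exists (x, (d - 1) * p%:Z + (p%:Z - 1)); first by rewrite /nbr /= k0; clear; lia.
  rewrite [LHS]surjective_pairing h2 e2 [RHS]surjective_pairing e2'; congr (_, _).
    by apply: val_inj; rewrite /= in e1' *; rewrite e1' [LHS]h1; clear -p_gt1; lia.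
  by rewrite mulrBr mulr1 addrA [RHS]rmorphB.
Qed.

Lemma torus_pr_adj v t : torus p q s (torus_pr v) t <-> exists2 w, nbr v w & t = torus_pr w.
Proof.
split=> [/orP[/torus_arc_nbr //|]|[w nw ->]].
  have [w <-] := torus_pr_surj t => /torus_arc_nbr[w' nw eqp].
  exists (v.1 + (w.1 - w'.1), v.2 + (w.2 - w'.2)).
    by move: nw; rewrite /nbr /=; clear; lia.
  by rewrite (torus_pr_shift _ _ eqp) !subrKC -surjective_pairing.
have [[e1 e2]|[[e1 e2]|[[e1 e2]|[e1 e2]]]] : w.1 = v.1 + 1 /\ w.2 = v.2 \/ v.1 = w.1 + 1 /\ v.2 = w.2
    \/ w.1 = v.1 /\ w.2 = v.2 + 1 \/ v.1 = w.1 /\ v.2 = w.2 + 1.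
- by move: nw; rewrite /nbr; clear; lia.
- by rewrite [w]surjective_pairing e1 e2.
- by rewrite torus_sym [v]surjective_pairing e1 e2.
- by rewrite [w]surjective_pairing e1 e2.
- by rewrite torus_sym [v]surjective_pairing e1 e2.
Qed.

End TorusCover.

(** * The lower bound *)

Lemma cycle_cover_card (f : nat -> bool) (L : nat) :
  (forall y, f y || f y.+1) -> f L = f 0%N -> (L <= 2 * \sum_(y < L) f y)%N.
Proof.
move=> cov per.
have shift : (\sum_(y < L) f y.+1 = \sum_(y < L) f y)%N.
  have : (f 0%N + \sum_(y < L) f y.+1 = \sum_(y < L) f y + f L)%N.
    by transitivity (\sum_(y < L.+1) f y)%N; [rewrite big_ord_recl | rewrite big_ord_recr].
  by rewrite per addnC => /addIn.
rewrite mul2n -addnn -{2}shift -big_split /=.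
rewrite -{1}[L]card_ord -sum1_card; apply: leq_sum => y _.
by have := cov y; case: (f y); case: (f y.+1).
Qed.

Section Lower.
Variables (T : finType) (e : rel T) (pr : int * int -> T) (g L : nat) (s : int).
Hypotheses (e_sym : symmetric e) (e_irr : irreflexive e) (cov : covers e pr g L s).
Hypotheses (g_gt0 : (0 < g)%N).

Let flip (v : int * int) : int * int :=
  (v.1 + (if (v.1 %% 2 == 0)%Z then 1 else -1), v.2).

Let flipK v : flip (flip v) = v.
Proof.
by case: v => x y; rewrite /flip /=; congr (_, _); case: ifP; case: ifP; clear; lia.
Qed.

Lemma rung_matching : exists2 M, perfect_matching e M & forall v, mate M (pr v) = pr (flip v).
Proof.
have [sur ker adj] := cov.
have ex t : exists v, pr v == t by have [v <-] := sur t; exists v.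
pose mu t := pr (flip (xchoose (ex t))).
have flip_pr v w : pr v = pr w -> pr (flip v) = pr (flip w).
  move/ker=> [u [t [h1 h2]]]; apply/ker; exists u, t; split; last by rewrite /= -h2.
  rewrite /flip /=; have -> : (v.1 %% 2 == 0)%Z = (w.1 %% 2 == 0)%Z by clear -h1; lia.
  by rewrite -h1; clear; lia.
have muE v : mu (pr v) = pr (flip v) by apply/flip_pr/eqP/(xchooseP (ex (pr v))).
have muK : involutive mu by move=> t; have [v <-] := sur t; rewrite !muE flipK.
have mu_adj t : e t (mu t).
  have [v <-] := sur t; rewrite muE; apply/adj; exists (flip v) => //.
  by rewrite /nbr /flip /=; case: ifP; clear; lia.
exists (matching_of mu); first exact: matching_ofP.
by move=> v; rewrite (mate_matching_of e_sym).
Qed.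

Lemma max_forcing_lower : (g * uphalf L <= max_forcing_number e)%N.
Proof.
have [sur ker adj] := cov; have [M pM mM] := rung_matching.
apply: leq_trans (leq_bigmax_cond _ pM); rewrite /forcing_number.
case: arg_minnP => [|S fS _]; first exact: forcing_set_self.
pose rung (k y : nat) : {set T} := [set pr (2 * k%:Z, y%:Z); pr (2 * k%:Z + 1, y%:Z)].
have mE k y : mate M (pr (2 * k, y)) = pr (2 * k + 1, y).
  by rewrite mM /flip /=; congr (pr (_ + _, _)); case: ifP; clear; lia.
have up k y : (rung k y \in S) || (rung k y.+1 \in S).
  rewrite /rung -!mE; apply: (forcing_square e_sym e_irr) => //.
  - by apply/adj; exists (2 * k%:Z, y.+1%:Z) => //; rewrite /nbr /=; clear; lia.
  - rewrite !mE; apply/adj; exists (2 * k%:Z + 1, y.+1%:Z) => //; rewrite /nbr /=; clear; lia.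
  - by rewrite mE; apply/eqP => /ker[u [t [/= h1 _]]]; clear -h1; lia.
have per k : (rung k L \in S) = (rung k 0%N \in S).
  rewrite /rung; have P x : pr (x, L%:Z) = pr (x, 0%N%:Z).
    by apply/ker; exists 0, 1 => /=; clear; lia.
  by rewrite !P.
pose R := [set ky : 'I_g * 'I_L | rung ky.1 ky.2 \in S].
have rung_inj : {in R &, injective (fun ky : 'I_g * 'I_L => rung ky.1 ky.2)}.
  move=> [i j] [i' j'] _ _ /= eqr.
  have := ltn_ord i; have := ltn_ord i'; have := ltn_ord j; have := ltn_ord j' => ltj' ltj lti' lti.
  have : pr (2 * i%:Z, j%:Z) \in rung i' j' by rewrite -eqr !inE eqxx.
  rewrite !inE => /orP[]/eqP/ker[u [t [/= h1 h2]]]; last by exfalso; clear -h1; lia.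
  have /mult_lt2 u1 : `|g%:Z * u| < 2 * g%:Z by clear -h1 lti lti'; lia.
  have u0 : u = 0 by clear -u1 h1 lti lti'; case: u1 => eu //; rewrite eu in h1; lia.
  rewrite u0 in h1 h2.
  have /mult_lt2 t1 : `|L%:Z * t| < 2 * L%:Z by clear -h2 ltj ltj'; lia.
  have ej : (j : nat) = j' by clear -t1 h2 ltj ltj'; case: t1 => et; rewrite et in h2; lia.
  have ei : (i : nat) = i' by clear -h1; lia.
  by congr (_, _); apply: val_inj.
have : (#|R| <= #|S|)%N.
  rewrite -(card_in_imset rung_inj); apply: subset_leq_card.
  by apply/subsetP => _ /imsetP[ky + ->]; rewrite inE.
apply: leq_trans.
have -> : #|R| = (\sum_(k < g) \sum_(y < L) (rung k y \in S))%N.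
  rewrite -sum1_card big_mkcond pair_big /=; apply: eq_bigr => ky _.
  by rewrite inE; case: (_ \in S).
rewrite -{1}[g]card_ord -sum_nat_const; apply: leq_sum => k _.
have := cycle_cover_card (up k) (per k).
by clear; lia.
Qed.

End Lower.

(** * The maximum forcing number *)

Lemma torus_covers (p g m' r' : nat) (t j : int) (p_gt1 : (1 < p)%N) :
  (1 < 2 * (g * m'))%N -> (0 < g)%N -> r'%:Z * t = 1 + m'%:Z * j ->
  covers (torus p (2 * (g * m')) (2 * (g * r')))
    (torus_pr (2 * (g * m')) (2 * (g * r')) p_gt1) g (p * m') (p%:Z * t).
Proof.
move=> q_gt1 g_gt0 bez; split=> [u|v w|v u].
- exact: torus_pr_surj.
- rewrite torus_pr_eq //.
  have -> : (2 * (g * m'))%N%:Z = 2 * g%:Z * m'%:Z by clear; lia.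
  have -> : (2 * (g * r'))%N%:Z = 2 * g%:Z * r'%:Z by clear; lia.
  have -> : (p * m')%N%:Z = p%:Z * m'%:Z by [].
  move: (v.1 - w.1) (v.2 - w.2) => X Y.
  split=> [[k [-> /dvdzP[l el]]]|[u [k [-> ->]]]].
    exists (m'%:Z * l - r'%:Z * k), (t * l - k * j); split.
      by rewrite -[X](addrK (2 * g%:Z * r'%:Z * k)) el; ring.
    apply/eqP; rewrite -subr_eq0; apply/eqP.
    transitivity (p%:Z * k * (1 + m'%:Z * j - r'%:Z * t)); first by ring.
    by rewrite bez; ring.
  exists (k * m'%:Z - u * t); split; first by ring.
  apply/dvdzP; exists (r'%:Z * k - u * j); apply/eqP; rewrite -subr_eq0; apply/eqP.
  transitivity (2 * g%:Z * u * (1 + m'%:Z * j - r'%:Z * t)); first by ring.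
  by rewrite bez; ring.
- exact: torus_pr_adj.
Qed.

Lemma card_torus_vertex (p q : nat) : (1 < q)%N -> #|torus_vertex p q| = (p * q)%N.
Proof. by move=> q_gt1; rewrite card_prod !card_ord Zp_cast. Qed.

Lemma max_forcing_torus (p m r : nat) : (2 < p)%N -> odd p -> (1 < m)%N -> (0 < r)%N ->
  max_forcing_number (torus p (2 * m) (2 * r)) = (gcdn r m * uphalf (p * (m %/ gcdn r m)))%N.
Proof.
move=> p_gt2 oddp m_gt1 r_gt0; set g := gcdn r m.
have g_gt0 : (0 < g)%N by rewrite gcdn_gt0 r_gt0.
have [m' em] := dvdnP (dvdn_gcdr r m); have [r' er] := dvdnP (dvdn_gcdl r m).
rewrite -/g in em er; have -> : (m %/ g = m')%N by rewrite {1}em mulnK.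
have m'_gt0 : (0 < m')%N by rewrite lt0n; apply: contraTneq m_gt1 => m0; rewrite em m0.
have [t [j bez]] : exists t j : int, r'%:Z * t = 1 + m'%:Z * j.
  have [u [v uv]] := Bezoutz r'%:Z m'%:Z.
  have cop : gcdz r'%:Z m'%:Z = 1.
    suff : gcdn r' m' = 1%N by rewrite /gcdz => ->.
    by apply/eqP; rewrite -(eqn_pmul2r g_gt0) mul1n muln_gcdl -er -em.
  by exists u, (- v); rewrite -cop -uv; ring.
have p_gt1 := ltnW p_gt2; have q_gt1 : (1 < 2 * m)%N by clear -m_gt1; lia.
have cov := torus_covers p_gt1 _ g_gt0 bez.
rewrite ![(g * _)%N]mulnC -em -er in cov; have {}cov := cov q_gt1.
have e_sym := @torus_sym p (2 * m) (2 * r); have e_irr := @torus_irr p (2 * m) (2 * r) p_gt1.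
have L_gt2 : (2 < p * m')%N by rewrite (leq_trans p_gt2) // leq_pmulr.
have sizeM M : perfect_matching (torus p (2 * m) (2 * r)) M -> #|M| = (g * (p * m'))%N.
  move=> /(card_matching e_irr); rewrite card_torus_vertex // => card2.
  by have := em; clear -card2; nia.
apply/eqP; rewrite eqn_leq (max_forcing_lower e_sym e_irr cov) // andbT.
apply/bigmax_leqP => M pM.
suff : (forcing_number (torus p (2 * m) (2 * r)) M + g * (p * m')./2 <= #|M|)%N.
  rewrite sizeM // => le; rewrite -(leq_add2r (g * (p * m')./2)) (leq_trans le) //.
  by rewrite -mulnDr; move: (p * m')%N => N; have -> : (uphalf N + N./2 = N)%N by clear; lia.
have [oddm|evm] := boolP (odd m').
  apply: (forcing_odd_height e_sym e_irr g_gt0 L_gt2 _ pM cov p_gt2).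
  - by rewrite oddM oddp.
  - exact: dvdn_mulr.
  - exact: dvdz_mulr.
  have [dv|ndv] := boolP ((p * m')%N%:Z %| p%:Z * t)%Z; last by right.
  left; have m1 : m' = 1%N.
    apply/eqP; rewrite -dvdn1 -[(_ %| _)%N]/(m'%:Z %| 1)%Z.
    have -> : 1 = r'%:Z * t - m'%:Z * j :> int by rewrite bez addrK.
    apply: rpredB; [apply: dvdz_mull | exact: dvdz_mulr].
    by move: dv; rewrite PoszM dvdz_mul2l //; clear -p_gt2; lia.
  by move: m_gt1; rewrite em m1 mul1n.
apply: (forcing_even_height e_sym e_irr cov) => //; first by rewrite oddM oddp.
have [a [ea|ea]] : exists a : int, t = 2 * a \/ t = 2 * a + 1.
- by exists (t %/ 2)%Z; clear; lia.
- have [c ec] : exists c : int, m'%:Z = 2 * c by exists m'./2%:Z; clear -evm; lia.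
  by exfalso; rewrite ea ec in bez; clear -bez; lia.
have [b ->] : exists b : int, p%:Z = 2 * b + 1 by exists p./2%:Z; clear -oddp; lia.
by rewrite ea; clear; lia.
Qed.

Local Close Scope ring_scope.

Theorem theorem5p1 (n m r : nat) (hn : 1 <= n) (hm : 2 <= m) (hr : 1 <= r <= m) :
  ((max_forcing_number (torus (2 * n + 1) (2 * m) (2 * r)))%:R =
     if odd (m %/ gcdn r m)
     then (m * (2 * n + 1) + gcdn r m)%N%:R / 2%:R
     else (m * (2 * n + 1))%N%:R / 2%:R :> rat)%R.
Proof.
have [r_gt0 _] := andP hr.
rewrite max_forcing_torus //; [|by clear -hn; lia|by rewrite oddD oddM].
set g := gcdn r m; have em : (m %/ g * g = m)%N by rewrite divnK // dvdn_gcdr.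
have half (a b : nat) : 2 * a = b -> (a%:R = b%:R / 2%:R :> rat)%R.
  by move=> <-; rewrite natrM mulrAC divff ?mul1r.
have [d ed] : exists d : bool, d = odd (m %/ g)%N by exists (odd (m %/ g)%N).
have up : (2 * uphalf ((2 * n + 1) * (m %/ g)) = (2 * n + 1) * (m %/ g) + d)%N.
  have <- : odd ((2 * n + 1) * (m %/ g)) = d by rewrite oddM oddD oddM ed.
  by clear; lia.
by rewrite -ed; case: d {ed} up => up; apply: half; rewrite mulnCA up -[in RHS]em /=;
  move: (m %/ g) => k; ring.
Qed.
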